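(* Let $0<\epsilon<1$ and let $B=(b_n)_{n\ge1}$ be an $\epsilon$-friendly sequence. Then there is a sequence $A=(a_n)_{n\ge1}$ of positive integers that interlaces $B$, i.e. $b_n\le a_n<b_{n+1}$ for all $n$, and which is $\epsilon$-complete.
   Context: For a sequence $B=(b_n)_{n\ge1}$, $\Delta b_n=b_{n+1}-b_n$ and $B(x)$ denotes the number of terms of $B$ that are at most $x$. A sequence $B$ of positive integers is $\epsilon$-friendly if: (i) for some constant $C$ and all $n$, $b_n\le\sum_{i\le\epsilon n+C}b_i$; (ii) $\lim_{n\to\infty}\Delta b_n=\infty$; (iii) $\lim_{i\to\infty}\frac{B(2^{i+1})-B(2^i)}{i}=\infty$; (iv) there exists $0<c<1$ such that $c\Delta b_i\le\Delta b_j$ for all $i<j$, and moreover if $b_j<2b_i$ then $\Delta b_j\le\frac1c\Delta b_i$; (v) $B$ is strictly increasing. For a sequence $A$ of positive integers, $\Sigma(A)$ is the set of sums of distinct terms of $A$; $A$ is complete if every sufficiently large positive integer lies in $\Sigma(A)$; $A$ is $\epsilon$-complete if every subsequence $A'$ of $A$ with $|A'\cap[n]|\ge\epsilon|A\cap[n]|$ for all sufficiently large $n$ is complete. *)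

(* Defs.v *)
(* sequences are functions nat -> nat indexed from 1
   (the value at index 0 is ignored); real parameters live in Stdlib's R. *)
From Stdlib Require Import Reals Lra Lia Arith List.
Open Scope R_scope.

Definition psum (s : nat -> nat) (K : nat) : nat :=
  fold_right Nat.add 0%nat (map s (seq 1 K)).

(* difference operator: Delta s n = s (n+1) - s n (used only where s is
   strictly increasing, so truncated subtraction is exact) *)
Definition Delta (s : nat -> nat) (n : nat) : nat := (s (S n) - s n)%nat.

(* number of indices k >= 1 in the index set P with s k <= x.
   For a strictly increasing sequence of positive integers s we have
   s k >= k, so every such k satisfies k <= x; hence counting over
   k in [1, x] gives exactly the number of terms (of the subsequence
   indexed by P) that are at most x. *)
Definition cntle (P : nat -> bool) (s : nat -> nat) (x : nat) : nat :=
  length (filter (fun k => andb (P k) (Nat.leb (s k) x)) (seq 1 x)).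

Definition Bcount (s : nat -> nat) (x : nat) : nat :=
  cntle (fun _ => true) s x.

Definition positive_seq (s : nat -> nat) : Prop :=
  forall n, (1 <= n)%nat -> (1 <= s n)%nat.

Definition strictly_increasing (s : nat -> nat) : Prop :=
  forall n, (1 <= n)%nat -> (s n < s (S n))%nat.

Definition eps_friendly (eps : R) (b : nat -> nat) : Prop :=
  positive_seq b /\
  (exists C : R, forall n, (1 <= n)%nat ->
      (b n <= psum b (Z.to_nat (Int_part (eps * INR n + C))))%nat) /\
  (forall M : nat, exists N : nat, forall n, (N <= n)%nat -> (M <= Delta b n)%nat) /\
  (forall M : R, exists I : nat, forall i, (1 <= i)%nat -> (I <= i)%nat ->
      M <= INR (Bcount b (2 ^ (S i)) - Bcount b (2 ^ i)) / INR i) /\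
  (exists c : R, 0 < c < 1 /\
     forall i j, (1 <= i)%nat -> (i < j)%nat ->
       c * INR (Delta b i) <= INR (Delta b j) /\
       ((b j < 2 * b i)%nat -> INR (Delta b j) <= / c * INR (Delta b i))) /\
  strictly_increasing b.

(* Sigma(A) restricted to an index set P: m is a sum of distinct terms
   a_k, k in P (distinct indices; the terms are distinct since A is
   injective in our application). *)
Definition in_subset_sums (P : nat -> bool) (a : nat -> nat) (m : nat) : Prop :=
  exists F : list nat, NoDup F /\
    (forall k, In k F -> (1 <= k)%nat /\ P k = true) /\
    m = fold_right Nat.add 0%nat (map a F).

Definition complete_sub (P : nat -> bool) (a : nat -> nat) : Prop :=
  exists M : nat, forall m, (M <= m)%nat -> in_subset_sums P a m.

Definition complete (a : nat -> nat) : Prop := complete_sub (fun _ => true) a.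

Definition eps_complete (eps : R) (a : nat -> nat) : Prop :=
  forall P : nat -> bool,
    (exists N : nat, forall n, (N <= n)%nat ->
        eps * INR (Bcount a n) <= INR (cntle P a n)) ->
    complete_sub P a.

(* Main.v *)
From Stdlib Require Import Reals Lra Lia Arith ZArith List Classical ClassicalEpsilon.
Require Import Defs.
Import ListNotations.
Open Scope nat_scope.

(**
The indices are cut into blocks of length about [log b], and [a] is chosen block by block, with
all terms congruent to 1 modulo a constant [E], by a greedy potential argument, so that for every
[T] containing a fixed proportion of a block and for every scale [s] up to the local gap size, two
subset sums of [T] differ by [E * k] with [s <= k <= G * s].  Indeed, if [X] is the set of subset
sums of part of [T] and two candidates [v < v'] for the next term both enlarge [X] by less than
half, then [X + v] and [X + v'] meet inside [X], so that [v' - v] is a difference of [X]; and [X]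
cannot grow by half more often than the logarithm of its size permits.

Let [P] be a subsequence of relative density [eps].  Its dense blocks give steps [E * k] with [k]
bounded; since [E] is divisible by all these [k] and the terms are 1 modulo [E], finitely many
terms of [P] produce all residues modulo [E * E] and hence an interval of subset sums.  Further
steps from dense blocks, and differences of nearby terms once the interval is longer than the
gaps, prolong it: for all large [l], a set [F] of at most [l / Y] indices of [P] up to [l] has
subset sums filling an interval of length at least [a (l / B0)].

Adding the other terms of [P] in increasing order preserves the interval if each of them is at
most its length plus the sum of its predecessors outside [F].  Condition (i) gives this up to the
loss of [F].  A term indexed by [n] can only fail if [P] has about [eps * n] terms before it, and
then the indices up to [eps * n] missing from [P] are replaced by larger ones; choosing [l] in
terms of their number makes this gain exceed the sum over [F].
*)

(** * Choosing the terms of one block *)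

Lemma psum_S (s : nat -> nat) (n : nat) : psum s (S n) = psum s n + s (S n).
Proof.
  unfold psum. rewrite seq_S, map_app, fold_right_app. cbn.
  generalize (map s (seq 1 n)). induction l; cbn; lia.
Qed.

Definition mem (y : nat) (X : list nat) : bool := existsb (Nat.eqb y) X.

Lemma mem_In (y : nat) (X : list nat) : mem y X = true <-> In y X.
Proof.
  unfold mem. rewrite existsb_exists. split.
  - intros (x & H & E). apply Nat.eqb_eq in E. now subst.
  - intros H. exists y. now rewrite Nat.eqb_refl.
Qed.

Definition fresh (v : nat) (X : list nat) : list nat :=
  filter (fun y => negb (mem y X)) (map (Nat.add v) X).

(** The union of [X] and [v + X], free of repetitions whenever [X] is, so that [length] counts
    subset sums. *)
Definition add_elt (v : nat) (X : list nat) : list nat := X ++ fresh v X.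

(** Passing to [add_elt v X] multiplies the size by at least 3/2 unless [v] is stuck. *)
Definition stuck (v : nat) (X : list nat) : bool :=
  2 * length (fresh v X) <? length X.

Definition has_diff (E lo hi : nat) (X : list nat) : bool :=
  existsb (fun x => existsb (fun y => existsb (fun k => y =? x + E * k)
    (seq lo (hi + 1 - lo))) X) X.

Lemma has_diff_iff (E lo hi : nat) (X : list nat) :
  has_diff E lo hi X = true <->
  exists x k, In x X /\ In (x + E * k) X /\ lo <= k <= hi.
Proof.
  unfold has_diff. rewrite existsb_exists. split.
  - intros (x & Hx & H). apply existsb_exists in H as (y & Hy & H).
    apply existsb_exists in H as (k & Hk & H). apply Nat.eqb_eq in H as ->.
    apply in_seq in Hk. exists x, k. repeat split; [easy|easy|lia|lia].
  - intros (x & k & Hx & Hy & H). exists x. split; [easy|].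
    apply existsb_exists. exists (x + E * k). split; [easy|].
    apply existsb_exists. exists k. split; [apply in_seq; lia|apply Nat.eqb_refl].
Qed.

Lemma NoDup_shift (v : nat) (X : list nat) : NoDup X -> NoDup (map (Nat.add v) X).
Proof.
  induction 1 as [|x X Hx _ IH]; cbn; constructor; [|exact IH].
  intros H. apply in_map_iff in H as (y & E & Hy). apply Hx. now replace x with y by lia.
Qed.

Lemma NoDup_add_elt (v : nat) (X : list nat) : NoDup X -> NoDup (add_elt v X).
Proof.
  intros H. apply NoDup_app; [easy| |].
  - apply NoDup_filter, NoDup_shift, H.
  - intros y Hy Hy'. apply filter_In in Hy' as [_ E].
    apply mem_In in Hy. now rewrite Hy in E.
Qed.

Lemma In_add_elt (v y : nat) (X : list nat) :
  In y (add_elt v X) <-> In y X \/ exists x, In x X /\ y = v + x.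
Proof.
  unfold add_elt, fresh. rewrite in_app_iff, filter_In, in_map_iff. split.
  - intros [H | [(x & E & Hx) _]]; [now left|right]. exists x. now split.
  - intros [H | (x & Hx & E)]; [now left|].
    destruct (mem y X) eqn:M; [left; now apply mem_In|right].
    split; [exists x; now split | easy].
Qed.

Lemma disjoint_halves (X A1 A2 : list nat) :
  NoDup A1 -> NoDup A2 -> incl A1 X -> incl A2 X ->
  length X < length A1 + length A2 -> exists z, In z A1 /\ In z A2.
Proof.
  intros N1 N2 I1 I2 L.
  destruct (existsb (fun z => mem z A2) A1) eqn:E.
  - apply existsb_exists in E as (z & H1 & H2). exists z.
    split; [easy|now apply mem_In].
  - exfalso. assert (N : NoDup (A1 ++ A2)).
    { apply NoDup_app; [easy|easy|]. intros z H1 H2.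
      rewrite <- Bool.not_true_iff_false in E. apply E, existsb_exists.
      exists z. split; [easy|now apply mem_In]. }
    apply NoDup_incl_length with (l' := X) in N; [|now apply incl_app].
    rewrite length_app in N. lia.
Qed.

Lemma filter_split_length {A : Type} (f : A -> bool) (l : list A) :
  length (filter f l) + length (filter (fun x => negb (f x)) l) = length l.
Proof. induction l as [|x l IH]; cbn; [easy|]. destruct (f x); cbn; lia. Qed.

(* Both translates meet [X] in more than half of its elements, so they meet each other. *)
Lemma stuck_stuck_diff (v1 v2 : nat) (X : list nat) :
  NoDup X -> v1 < v2 -> stuck v1 X = true -> stuck v2 X = true ->
  exists x y, In x X /\ In y X /\ y = x + (v2 - v1).
Proof.
  intros N Hv S1 S2. apply Nat.ltb_lt in S1, S2.
  pose (A v := filter (fun y => mem y X) (map (Nat.add v) X)).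
  assert (LA : forall v, length (A v) + length (fresh v X) = length X).
  { intros v. unfold A, fresh. rewrite filter_split_length. apply length_map. }
  destruct (disjoint_halves X (A v1) (A v2)) as (z & H1 & H2).
  - apply NoDup_filter, NoDup_shift, N.
  - apply NoDup_filter, NoDup_shift, N.
  - intros y Hy. apply filter_In in Hy as [_ Hy]. now apply mem_In.
  - intros y Hy. apply filter_In in Hy as [_ Hy]. now apply mem_In.
  - pose proof (LA v1). pose proof (LA v2). lia.
  - apply filter_In in H1 as [H1 _], H2 as [H2 _].
    apply in_map_iff in H1 as (y & E1 & Hy), H2 as (x & E2 & Hx).
    exists x, y. repeat split; [easy|easy|lia].
Qed.

(** All marked indices lie in the window of length [sg] that ends at the last of them. *)
Lemma count_close (R : nat -> bool) (s sg len : nat) :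
  (forall i j, s <= i < j -> j < s + len -> R i = true -> R j = true -> j < i + sg) ->
  1 <= sg -> length (filter R (seq s len)) <= sg.
Proof.
  intros H Hs. induction len as [|len IH]; [cbn; lia|].
  destruct (R (s + len)) eqn:E.
  - transitivity (length (seq (s + len + 1 - sg) sg)); [|now rewrite length_seq].
    apply NoDup_incl_length.
    + apply NoDup_filter, seq_NoDup.
    + intros i Hi. apply filter_In in Hi as [Hi Ri]. apply in_seq in Hi.
      apply in_seq. destruct (Nat.eq_dec i (s + len)); [lia|].
      specialize (H i (s + len) ltac:(lia) ltac:(lia) Ri E). lia.
  - rewrite seq_S, filter_app, length_app. cbn. rewrite E. cbn.
    rewrite Nat.add_0_r. apply IH. intros i j Hi Hj. apply H; lia.
Qed.

(** Cut the range into windows of length [G * sg]. Two marked indices in one window differ by less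
    than [G * sg], hence by less than [sg], so each window holds at most [sg] of them; the additive
    term covers the last window. *)
Lemma count_avoiding (R : nat -> bool) (G sg : nat) :
  1 <= sg -> 1 <= G ->
  forall len s,
  (forall i j, s <= i < j -> j < s + len -> R i = true -> R j = true ->
     ~ (i + sg <= j <= i + G * sg)) ->
  G * length (filter R (seq s len)) <= len + G * sg.
Proof.
  intros Hs HG len. assert (P : 1 <= G * sg) by nia. induction len as [len IH] using lt_wf_ind. intros s H.
  destruct (Nat.le_gt_cases len (G * sg)) as [Hl|Hl].
  - enough (length (filter R (seq s len)) <= sg) by nia.
    apply count_close; [|easy]. intros i j Hi Hj Ri Rj.
    specialize (H i j Hi Hj Ri Rj). lia.
  - replace len with (G * sg + (len - G * sg)) by lia.
    rewrite seq_app, filter_app, length_app.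
    assert (H1 : length (filter R (seq s (G * sg))) <= sg).
    { apply count_close; [|easy]. intros i j Hi Hj Ri Rj.
      specialize (H i j Hi ltac:(lia) Ri Rj). lia. }
    assert (H2 : G * length (filter R (seq (s + G * sg) (len - G * sg)))
                 <= (len - G * sg) + G * sg).
    { apply IH; [lia|]. intros i j Hi Hj. apply H; lia. }
    nia.
Qed.

Lemma list_sum_map_add {A : Type} (f g : A -> nat) (l : list A) :
  list_sum (map (fun x => f x + g x) l) = list_sum (map f l) + list_sum (map g l).
Proof. unfold list_sum. induction l; cbn; lia. Qed.

Lemma list_sum_map_mul {A : Type} (c : nat) (f : A -> nat) (l : list A) :
  list_sum (map (fun x => c * f x) l) = c * list_sum (map f l).
Proof. unfold list_sum. induction l; cbn; lia. Qed.

Lemma list_sum_map_le {A : Type} (f g : A -> nat) (l : list A) :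
  (forall x, In x l -> f x <= g x) ->
  list_sum (map f l) <= list_sum (map g l).
Proof.
  induction l as [|x l IH]; cbn; intros H; [lia|].
  pose proof (H x (or_introl eq_refl)). specialize (IH (fun y Hy => H y (or_intror Hy))).
  unfold list_sum in IH. lia.
Qed.

Lemma list_sum_swap {A B : Type} (f : A -> B -> nat) (l : list A) (l' : list B) :
  list_sum (map (fun x => list_sum (map (f x) l')) l) =
  list_sum (map (fun y => list_sum (map (fun x => f x y) l)) l').
Proof.
  induction l as [|x l IH]; cbn.
  - induction l'; cbn; auto.
  - change (list_sum (map (f x) l') +
      list_sum (map (fun x => list_sum (map (f x) l')) l) =
      list_sum (map (fun y => f x y + list_sum (map (fun x => f x y) l)) l')).
    rewrite IH, list_sum_map_add. reflexivity.
Qed.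

Lemma exists_le_average (f : nat -> nat) (g B : nat) :
  1 <= g -> list_sum (map f (seq 0 g)) <= g * B -> exists w, w < g /\ f w <= B.
Proof.
  intros Hg H.
  assert (A : forall n s, (forall w, s <= w < s + n -> B < f w) ->
             n * (B + 1) <= list_sum (map f (seq s n))).
  { induction n as [|n IH]; intros s HB; cbn; [lia|].
    pose proof (HB s ltac:(lia)). specialize (IH (S s) ltac:(intros; apply HB; lia)).
    unfold list_sum in IH. lia. }
  destruct (existsb (fun w => f w <=? B) (seq 0 g)) eqn:E.
  - apply existsb_exists in E as (w & Hw & Hf). apply in_seq in Hw.
    apply Nat.leb_le in Hf. exists w. lia.
  - exfalso. specialize (A g 0). enough (g * (B + 1) <= g * B) by nia.
    etransitivity; [apply A|exact H]. intros w Hw.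
    apply Nat.nle_gt. intros C. rewrite <- Bool.not_true_iff_false in E.
    apply E, existsb_exists. exists w. split; [apply in_seq; lia|now apply Nat.leb_le].
Qed.

(* Weights of the potential argument: a state is a scale [s] with the set [X] of subset sums of
   some index set [T]; its weight is multiplied by [lam] when a new element fails to enlarge [X]
   by half, and dropped once [X] contains a difference of scale [s]. *)
Definition factor (lam E lo hi : nat) (X : list nat) (v : nat) : nat :=
  if has_diff E lo hi X then 0 else if stuck v X then lam else 1.

(* Two stuck candidates at distance [E * k] give [X] a difference [E * k], so without a
   difference of scale [sg] at most a proportion [1 / lam] of the candidates is stuck. *)
Lemma factor_average (lam E sg g base : nat) (X : list nat) :
  1 <= lam -> 1 <= sg -> 1 <= E -> NoDup X -> 2 * lam * sg <= g ->
  list_sum (map (fun w => factor lam E sg (2 * lam * sg) X (base + E * w))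
     (seq 0 g)) <= 2 * g.
Proof.
  intros Hl Hs HE N Hg.
  destruct (has_diff E sg (2 * lam * sg) X) eqn:D.
  - unfold factor. rewrite D. generalize (seq 0 g). induction l; cbn; unfold list_sum in *; lia.
  - pose (R w := stuck (base + E * w) X).
    assert (C : 2 * lam * length (filter R (seq 0 g)) <= g + 2 * lam * sg).
    { apply count_avoiding; [easy|lia|]. intros i j Hi _ Ri Rj Hij.
      rewrite <- Bool.not_true_iff_false in D. apply D, has_diff_iff.
      destruct (stuck_stuck_diff (base + E * i) (base + E * j) X) as (x & y & Hx & Hy & Exy);
        [easy|nia|easy|easy|].
      exists x, (j - i). replace (x + E * (j - i)) with y by nia. auto with *. }
    unfold factor. rewrite D.
    change (list_sum (map (fun w => if R w then lam else 1) (seq 0 g)) <= 2 * g).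
    clearbody R.
    transitivity (lam * length (filter R (seq 0 g)) + length (seq 0 g));
      [|rewrite length_seq; lia].
    unfold list_sum. generalize (seq 0 g). induction l as [|w l IH]; [cbn; lia|].
    cbn. destruct (R w); cbn [length]; lia.
Qed.

(** * The potential and its greedy control *)

Definition state : Type := (nat * list nat * nat)%type.

Definition gain_of (lam E : nat) (v : nat) (t : state) : nat :=
  let '(s, X, w) := t in w * factor lam E s (2 * lam * s) X v.

Definition move (lam E v : nat) (t : state) : state :=
  let '(s, X, w) := t in (s, add_elt v X, gain_of lam E v t).

(** One state for each scale and each set of indices among the first [L] of the block: the old
    states omit the new index, their images under [move] contain it. *)
Fixpoint states (lam E smax : nat) (a : nat -> nat) (e L : nat) : list state :=
  match L with
  | 0 => map (fun s => (s, [0], 1)) (seq 1 smax)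
  | S L' => let st := states lam E smax a e L' in
            st ++ map (move lam E (a (e + L'))) st
  end.

Definition total (st : list state) : nat := list_sum (map snd st).

Lemma total_move (lam E v : nat) (st : list state) :
  total (st ++ map (move lam E v) st) =
  total st + list_sum (map (gain_of lam E v) st).
Proof.
  unfold total. rewrite map_app, list_sum_app, map_map. f_equal. f_equal.
  apply map_ext. intros [[s X] w]. reflexivity.
Qed.

Definition valid (smax : nat) (t : state) : Prop :=
  let '(s, X, _) := t in 1 <= s <= smax /\ NoDup X.

Lemma states_valid (lam E smax : nat) (a : nat -> nat) (e L : nat) (t : state) :
  In t (states lam E smax a e L) -> valid smax t.
Proof.
  revert t. induction L as [|L IH]; cbn; intros t H.
  - apply in_map_iff in H as (s & <- & H). apply in_seq in H. cbn.
    split; [lia|]. repeat constructor. easy.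
  - apply in_app_or in H as [H|H]; [now apply IH|].
    apply in_map_iff in H as ([[s X] w] & <- & H). apply IH in H as [H1 H2].
    cbn. split; [easy|]. now apply NoDup_add_elt.
Qed.

Lemma states_ext (lam E smax : nat) (a a' : nat -> nat) (e L : nat) :
  (forall n, e <= n < e + L -> a n = a' n) ->
  states lam E smax a e L = states lam E smax a' e L.
Proof.
  induction L as [|L IH]; cbn; intros H; [easy|].
  rewrite IH by (intros; apply H; lia). now rewrite (H (e + L)) by lia.
Qed.

(** Averaged over the [g] candidates, the gain of a single state is at most twice its weight. After
    exchanging the two sums, some candidate achieves this for the total. *)
Lemma gain_average (lam E smax g base : nat) (st : list state) :
  1 <= lam -> 1 <= E -> 2 * lam * smax <= g -> 1 <= g ->
  (forall t, In t st -> valid smax t) ->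
  exists w, w < g /\ list_sum (map (gain_of lam E (base + E * w)) st) <= 2 * total st.
Proof.
  intros Hl HE Hg Hg1 V. apply exists_le_average; [easy|].
  rewrite (list_sum_swap (fun w t => gain_of lam E (base + E * w) t)).
  unfold total. rewrite Nat.mul_assoc, <- list_sum_map_mul.
  apply list_sum_map_le. intros [[s X] w] Ht. apply V in Ht as [Hs N]. cbn [gain_of snd].
  rewrite list_sum_map_mul.
  pose proof (factor_average lam E s g base X Hl (proj1 Hs) HE N
    ltac:(etransitivity; [apply Nat.mul_le_mono_l, (proj2 Hs)|exact Hg])). nia.
Qed.

(** Each step keeps the old states and adds moved ones of at most twice the old total, so the total
    is at most tripled. It starts at [smax], with weight 1 for each scale. *)
Lemma greedy_choice (lam E smax e : nat) (base g : nat -> nat) (L : nat) :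
  1 <= lam -> 1 <= E ->
  (forall n, e <= n < e + L -> 2 * lam * smax <= g n /\ 1 <= g n) ->
  exists a : nat -> nat,
    (forall n, e <= n < e + L -> exists w, w < g n /\ a n = base n + E * w) /\
    total (states lam E smax a e L) <= 3 ^ L * smax.
Proof.
  intros Hl HE. induction L as [|L IH]; intros Hg.
  - exists (fun _ => 0). split; [lia|]. unfold total. cbn. rewrite map_map. cbn.
    transitivity (length (seq 1 smax)); [|rewrite length_seq; lia].
    unfold list_sum. generalize (seq 1 smax). induction l; cbn; lia.
  - destruct IH as (a & Ha & Ht); [intros; apply Hg; lia|].
    destruct (Hg (e + L) ltac:(lia)) as [H1 H2].
    destruct (gain_average lam E smax (g (e + L)) (base (e + L))
                (states lam E smax a e L)) as (w & Hw & Hs); [easy|easy|easy|easy| |].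
    { apply states_valid. }
    exists (fun n => if n =? e + L then base (e + L) + E * w else a n). split.
    + intros n Hn. destruct (Nat.eqb_spec n (e + L)) as [->|Hne].
      * exists w. now split.
      * apply Ha. lia.
    + cbn [states]. rewrite Nat.eqb_refl.
      rewrite (states_ext lam E smax _ a e L).
      2:{ intros n Hn. destruct (Nat.eqb_spec n (e + L)); [lia|easy]. }
      rewrite total_move. cbn [Nat.pow]. lia.
Qed.

(** * The run along a fixed index set *)

Fixpoint rsum (f : nat -> nat) (e L : nat) : nat :=
  match L with 0 => 0 | S L' => rsum f e L' + f (e + L') end.

Definition ind (T : nat -> bool) (n : nat) : nat := if T n then 1 else 0.

Fixpoint sums_of (a : nat -> nat) (T : nat -> bool) (e L : nat) : list nat :=
  match L with
  | 0 => [0]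
  | S L' => let X := sums_of a T e L' in
            if T (e + L') then add_elt (a (e + L')) X else X
  end.

Fixpoint weight_of (lam E lo hi : nat) (a : nat -> nat) (T : nat -> bool) (e L : nat) : nat :=
  match L with
  | 0 => 1
  | S L' => let w := weight_of lam E lo hi a T e L' in
            if T (e + L') then w * factor lam E lo hi (sums_of a T e L') (a (e + L')) else w
  end.

(** Every [T] is one of the histories enumerated by [states], so the total bounds the weight of its
    run. *)
Lemma run_in_states (lam E smax s : nat) (a : nat -> nat) (T : nat -> bool) (e L : nat) :
  1 <= s <= smax ->
  In (s, sums_of a T e L, weight_of lam E s (2 * lam * s) a T e L)
     (states lam E smax a e L).
Proof.
  intros Hs. induction L as [|L IH]; cbn [states sums_of weight_of].
  - apply in_map_iff. exists s. split; [easy|]. apply in_seq. lia.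
  - apply in_or_app. destruct (T (e + L)); [right|now left].
    apply in_map_iff. eexists. split; [|exact IH]. reflexivity.
Qed.

Lemma In_le_list_sum (x : nat) (l : list nat) : In x l -> x <= list_sum l.
Proof.
  unfold list_sum. induction l as [|y l IH]; cbn; [easy|]. intros [->|H]; [lia|].
  specialize (IH H). lia.
Qed.

Lemma NoDup_sums_of (a : nat -> nat) (T : nat -> bool) (e L : nat) : NoDup (sums_of a T e L).
Proof.
  induction L as [|L IH]; cbn; [repeat constructor; easy|].
  destruct (T (e + L)); [now apply NoDup_add_elt|easy].
Qed.

(** Since [sums_of] only grows, a difference absent at the end was absent throughout, and the weight
    was never dropped. Each element of [T] then either is stuck and multiplies the weight by [lam],
    or enlarges the set by a factor of at least 3/2. *)
Lemma run_counts (lam E lo hi : nat) (a : nat -> nat) (T : nat -> bool) (e L : nat) :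
  has_diff E lo hi (sums_of a T e L) = false ->
  exists grow stk, grow + stk = rsum (ind T) e L /\
    weight_of lam E lo hi a T e L = lam ^ stk /\
    3 ^ grow <= 2 ^ grow * length (sums_of a T e L).
Proof.
  induction L as [|L IH]; cbn; intros D.
  - exists 0, 0. cbn. repeat split; lia.
  - assert (Ei : ind T (e + L) = if T (e + L) then 1 else 0) by easy. rewrite Ei.
    destruct (T (e + L)).
    2:{ destruct (IH D) as (gr & st & H). exists gr, st. now rewrite Nat.add_0_r. }
    assert (D' : has_diff E lo hi (sums_of a T e L) = false).
    { apply Bool.not_true_iff_false. intros C. apply has_diff_iff in C as (x & k & Hx & Hy & H).
      rewrite <- Bool.not_true_iff_false in D. apply D, has_diff_iff.
      exists x, k. rewrite !In_add_elt. auto. }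
    destruct (IH D') as (gr & st & H1 & H2 & H3).
    unfold factor. rewrite D', H2. unfold add_elt. rewrite length_app.
    destruct (stuck (a (e + L)) (sums_of a T e L)) eqn:Es.
    + exists gr, (S st). repeat split; [lia|cbn; lia|nia].
    + exists (S gr), st. repeat split; [lia|cbn; lia|].
      apply Nat.ltb_ge in Es. cbn [Nat.pow]. nia.
Qed.

Lemma sums_of_le (a : nat -> nat) (T : nat -> bool) (e L B : nat) :
  (forall n, e <= n < e + L -> a n <= B) ->
  forall x, In x (sums_of a T e L) -> x <= L * B.
Proof.
  induction L as [|L IH]; cbn; intros H x Hx; [lia|].
  assert (IH' : forall x, In x (sums_of a T e L) -> x <= L * B)
    by (apply IH; intros; apply H; lia).
  pose proof (H (e + L) ltac:(lia)).
  destruct (T (e + L)); [|apply IH' in Hx; lia].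
  apply In_add_elt in Hx as [Hx|(y & Hy & ->)]; [apply IH' in Hx; lia|].
  apply IH' in Hy. lia.
Qed.

Definition restrict (T : nat -> bool) (e L : nat) (n : nat) : bool :=
  andb (T n) (andb (e <=? n) (n <? e + L)).

Lemma restrict_iff (T : nat -> bool) (e L n : nat) :
  restrict T e L n = true <-> T n = true /\ e <= n < e + L.
Proof.
  unfold restrict. rewrite !Bool.andb_true_iff, Nat.leb_le, Nat.ltb_lt. tauto.
Qed.

Lemma sums_of_subset_sums (a : nat -> nat) (T : nat -> bool) (e L x : nat) :
  1 <= e -> In x (sums_of a T e L) -> in_subset_sums (restrict T e L) a x.
Proof.
  intros He. revert x. induction L as [|L IH]; cbn; intros x Hx.
  - destruct Hx as [<-|[]]. exists []. repeat split; easy || constructor.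
  - assert (W : forall y, In y (sums_of a T e L) -> in_subset_sums (restrict T e (S L)) a y).
    { intros y Hy. destruct (IH y Hy) as (F & N & HF & E). exists F.
      repeat split; [easy|now apply HF| |easy].
      apply restrict_iff. apply HF in H as [_ H]. apply restrict_iff in H as [H H']. split; [easy|lia]. }
    destruct (T (e + L)) eqn:ET; [|now apply W].
    apply In_add_elt in Hx as [Hx|(y & Hy & ->)]; [now apply W|].
    destruct (IH y Hy) as (F & N & HF & E). exists (e + L :: F). repeat split.
    + constructor; [|easy]. intros C. apply HF in C as [_ C].
      apply restrict_iff in C. lia.
    + destruct H as [<-|H]; [lia|now apply HF].
    + apply restrict_iff. destruct H as [<-|H]; [split; [easy|lia]|].
      apply HF in H as [_ H]. apply restrict_iff in H as [H H']. split; [easy|lia].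
    + cbn. lia.
Qed.

(* A set [T] with [4 * z] elements and no difference of scale [s] would be stuck more than [2 * z]
   times, as [X] has at most [2 ^ z] elements; its weight would exceed the potential. *)
Lemma interval_choice (Q z E smax e B : nat) (base g : nat -> nat) :
  let lam := 6 ^ (8 * Q) in
  let L := 16 * Q * z in
  1 <= E -> 1 <= e -> 1 <= Q -> 1 <= z ->
  (forall n, e <= n < e + L -> 2 * lam * smax <= g n /\ 1 <= g n) ->
  (forall n, e <= n < e + L -> base n + E * g n <= B) ->
  smax <= 2 ^ z -> L * B < 2 ^ z ->
  exists a : nat -> nat,
    (forall n, e <= n < e + L -> exists w, w < g n /\ a n = base n + E * w) /\
    forall T, 4 * z <= rsum (ind T) e L -> forall s, 1 <= s <= smax ->
    exists x k, in_subset_sums (restrict T e L) a x /\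
      in_subset_sums (restrict T e L) a (x + E * k) /\ s <= k <= 2 * lam * s.
Proof.
  intros lam L HE He HQ Hz Hg HB Hsm HL.
  assert (Hlam : 1 <= lam) by (apply Nat.neq_0_lt_0, Nat.pow_nonzero; lia).
  destruct (greedy_choice lam E smax e base g L Hlam HE Hg) as (a & Ha & Ht).
  exists a. split; [exact Ha|]. intros T HT s Hs.
  destruct (has_diff E s (2 * lam * s) (sums_of a T e L)) eqn:D.
  { apply has_diff_iff in D as (x & k & Hx & Hy & H). exists x, k.
    repeat split; [now apply sums_of_subset_sums|now apply sums_of_subset_sums|lia|lia]. }
  exfalso.
  assert (Hlen : length (sums_of a T e L) <= 2 ^ z).
  { transitivity (length (seq 0 (S (L * B)))); [|rewrite length_seq; lia].
    apply NoDup_incl_length; [apply NoDup_sums_of|]. intros x Hx.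
    apply in_seq. enough (x <= L * B) by lia.
    revert x Hx. apply sums_of_le. intros n Hn.
    destruct (Ha n Hn) as (w & Hw & ->). specialize (HB n Hn). nia. }
  destruct (run_counts lam E _ _ a T e L D) as (gr & st & H1 & H2 & H3).
  pose proof (run_in_states lam E smax s a T e L Hs) as Hin.
  apply (in_map snd), In_le_list_sum in Hin. cbn [snd] in Hin.
  fold (total (states lam E smax a e L)) in Hin. rewrite H2 in Hin.
  (* Otherwise the set would have at least [(9/4) ^ z] elements, which is more than [2 ^ z]. *)
  assert (Hgr : gr < 2 * z).
  { apply Nat.nle_gt. intros C.
    assert (E1 : 9 ^ z <= 8 ^ z).
    { replace 9 with (3 ^ 2) by easy. replace 8 with (2 ^ 2 * 2) by easy.
      rewrite Nat.pow_mul_l, <- !Nat.pow_mul_r.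
      replace gr with (2 * z + (gr - 2 * z)) in H3 by lia.
      rewrite !Nat.pow_add_r in H3.
      assert (P1 : 2 ^ (gr - 2 * z) <= 3 ^ (gr - 2 * z)) by (apply Nat.pow_le_mono_l; lia).
      assert (P2 : 1 <= 2 ^ (gr - 2 * z)) by (apply Nat.neq_0_lt_0, Nat.pow_nonzero; lia).
      apply Nat.mul_le_mono_pos_r with (p := 2 ^ (gr - 2 * z)); [lia|].
      etransitivity; [apply Nat.mul_le_mono_l, P1|]. etransitivity; [exact H3|].
      rewrite <- !Nat.mul_assoc. apply Nat.mul_le_mono_l.
      rewrite Nat.mul_comm. now apply Nat.mul_le_mono_r. }
    assert (8 ^ z < 9 ^ z) by (apply Nat.pow_lt_mono_l; lia). lia. }
  assert (C1 : 3 ^ L * smax <= 6 ^ L).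
  { replace 6 with (3 * 2) by easy. rewrite Nat.pow_mul_l. apply Nat.mul_le_mono_l.
    etransitivity; [exact Hsm|]. apply Nat.pow_le_mono_r; [lia|]. unfold L. nia. }
  (* More than [2 * z] stuck steps give [6] the exponent [8 * Q * st], which exceeds
     [L = 16 * Q * z]. *)
  assert (C2 : 6 ^ L < lam ^ st).
  { unfold lam. rewrite <- Nat.pow_mul_r. apply Nat.pow_lt_mono_r; [lia|]. unfold L. nia. }
  lia.
Qed.

(** * Sums over index sets *)

Lemma psum_add (f : nat -> nat) (k r : nat) :
  psum f (k + r) = psum f k + psum (fun j => f (k + j)) r.
Proof.
  induction r as [|r IH]; [rewrite Nat.add_0_r; cbn; lia|].
  rewrite Nat.add_succ_r, !psum_S, IH, Nat.add_succ_r. lia.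
Qed.

Lemma psum_le (f g : nat -> nat) (n : nat) :
  (forall j, 1 <= j <= n -> f j <= g j) -> psum f n <= psum g n.
Proof.
  induction n as [|n IH]; intros H; [easy|]. rewrite !psum_S.
  pose proof (H (S n) ltac:(lia)). specialize (IH ltac:(intros; apply H; lia)). lia.
Qed.

Lemma psum_ext (f g : nat -> nat) (n : nat) :
  (forall j, 1 <= j <= n -> f j = g j) -> psum f n = psum g n.
Proof.
  intros H. apply Nat.le_antisymm; apply psum_le; intros j Hj; rewrite H; easy.
Qed.

Lemma psum_plus (f g : nat -> nat) (n : nat) :
  psum (fun j => f j + g j) n = psum f n + psum g n.
Proof. induction n as [|n IH]; [easy|]. rewrite !psum_S, IH. lia. Qed.

Lemma psum_scale (c : nat) (f : nat -> nat) (n : nat) :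
  psum (fun j => c * f j) n = c * psum f n.
Proof. induction n as [|n IH]; [cbn; lia|]. rewrite !psum_S, IH. lia. Qed.

Lemma psum_const (c n : nat) : psum (fun _ => c) n = n * c.
Proof. induction n as [|n IH]; [easy|]. rewrite psum_S, IH. lia. Qed.

Lemma psum_mono (f : nat -> nat) (m n : nat) : m <= n -> psum f m <= psum f n.
Proof. intros H. replace n with (m + (n - m)) by lia. rewrite psum_add. lia. Qed.

Definition sel (A : nat -> bool) (a : nat -> nat) (j : nat) : nat := if A j then a j else 0.
Definition cnt (A : nat -> bool) (n : nat) : nat := psum (ind A) n.
Definition compl (A : nat -> bool) (j : nat) : bool := negb (A j).
Definition minus (A F : nat -> bool) (j : nat) : bool := andb (A j) (negb (F j)).
Definition shift {B : Type} (k : nat) (f : nat -> B) (j : nat) : B := f (k + j).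
Definition increasing (a : nat -> nat) : Prop := forall i j, 1 <= i < j -> a i < a j.

Lemma increasing_le (a : nat -> nat) (i j : nat) : increasing a -> 1 <= i <= j -> a i <= a j.
Proof.
  intros H Hij. destruct (Nat.eq_dec i j) as [->|Hne]; [easy|].
  apply Nat.lt_le_incl, H. lia.
Qed.

Lemma cnt_S (A : nat -> bool) (n : nat) : cnt A (S n) = cnt A n + ind A (S n).
Proof. apply psum_S. Qed.

Lemma ind_le_1 (A : nat -> bool) (n : nat) : ind A n <= 1.
Proof. unfold ind. destruct (A n); lia. Qed.

Lemma cnt_le (A : nat -> bool) (n : nat) : cnt A n <= n.
Proof.
  induction n as [|n IH]; [easy|]. rewrite cnt_S. pose proof (ind_le_1 A (S n)). lia.
Qed.

Lemma cnt_add (A : nat -> bool) (k r : nat) : cnt A (k + r) = cnt A k + cnt (shift k A) r.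
Proof. apply psum_add. Qed.

Lemma cnt_mono (A : nat -> bool) (m n : nat) : m <= n -> cnt A m <= cnt A n.
Proof. apply psum_mono. Qed.

Lemma cnt_compl (A : nat -> bool) (n : nat) : cnt A n + cnt (compl A) n = n.
Proof.
  induction n as [|n IH]; [easy|]. rewrite !cnt_S. unfold ind, compl at 2.
  destruct (A (S n)); cbn; lia.
Qed.

Lemma psum_sel_compl (A : nat -> bool) (a : nat -> nat) (n : nat) :
  psum (sel A a) n + psum (sel (compl A) a) n = psum a n.
Proof.
  rewrite <- psum_plus. apply psum_ext. intros j _. unfold sel, compl.
  destruct (A j); cbn; lia.
Qed.

Lemma psum_sel_minus (A F : nat -> bool) (a : nat -> nat) (n : nat) :
  (forall j, F j = true -> A j = true) ->
  psum (sel (minus A F) a) n + psum (sel F a) n = psum (sel A a) n.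
Proof.
  intros H. rewrite <- psum_plus. apply psum_ext. intros j _. unfold sel, minus.
  specialize (H j). destruct (F j); [rewrite H by easy|destruct (A j)]; cbn; lia.
Qed.

Lemma cnt_minus (A F : nat -> bool) (n : nat) :
  (forall j, F j = true -> A j = true) -> cnt (minus A F) n + cnt F n = cnt A n.
Proof. apply (psum_sel_minus A F (fun _ => 1)). Qed.

Lemma psum_sel_bounded (F : nat -> bool) (a : nat -> nat) (l n : nat) :
  (forall j, F j = true -> 1 <= j <= l) -> psum (sel F a) n <= psum (sel F a) l.
Proof.
  intros H. destruct (Nat.le_gt_cases n l) as [Hn|Hn]; [now apply psum_mono|].
  replace n with (l + (n - l)) by lia. rewrite psum_add.
  rewrite (psum_ext (fun j => sel F a (l + j)) (fun _ => 0)), psum_const; [lia|].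
  intros j Hj. unfold sel. destruct (F (l + j)) eqn:E; [|easy]. apply H in E. lia.
Qed.

Lemma cnt_bounded (F : nat -> bool) (l n : nat) :
  (forall j, F j = true -> 1 <= j <= l) -> cnt F n <= cnt F l.
Proof. apply (psum_sel_bounded F (fun _ => 1)). Qed.

Lemma psum_sel_le_cnt (A : nat -> bool) (a : nat -> nat) (c n : nat) :
  (forall j, 1 <= j <= n -> A j = true -> a j <= c) -> psum (sel A a) n <= cnt A n * c.
Proof.
  intros H. unfold cnt. rewrite Nat.mul_comm, <- psum_scale. apply psum_le.
  intros j Hj. specialize (H j Hj). unfold sel, ind. destruct (A j); [|lia].
  specialize (H eq_refl). lia.
Qed.

(** The [i]-th element of [A] is at least [i]. *)
Lemma psum_sel_lower (A : nat -> bool) (a : nat -> nat) (n : nat) :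
  increasing a -> psum a (cnt A n) <= psum (sel A a) n.
Proof.
  intros I. induction n as [|n IH]; [easy|]. rewrite cnt_S, psum_S. unfold ind, sel at 2.
  destruct (A (S n)).
  - rewrite Nat.add_1_r, psum_S. pose proof (cnt_le A n).
    pose proof (increasing_le a (S (cnt A n)) (S n) I). lia.
  - rewrite Nat.add_0_r. lia.
Qed.

(** The sum only grows when the elements of [A] up to [n] are pushed to the last places up to
    [n]. *)
Lemma psum_sel_upper (A : nat -> bool) (a : nat -> nat) (n : nat) :
  increasing a -> psum (sel A a) n <= psum (shift (n - cnt A n) a) (cnt A n).
Proof.
  intros I. induction n as [|n IH]; [easy|]. rewrite cnt_S, psum_S. unfold ind, sel at 2.
  pose proof (cnt_le A n). destruct (A (S n)).
  - rewrite Nat.add_1_r, psum_S. cbn [Nat.sub].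
    unfold shift at 2. replace (n - cnt A n + S (cnt A n)) with (S n) by lia.
    lia.
  - rewrite !Nat.add_0_r. etransitivity; [exact IH|]. apply psum_le. intros j Hj.
    unfold shift. apply increasing_le; [easy|lia].
Qed.

Lemma increasing_shift (k : nat) (a : nat -> nat) : increasing a -> increasing (shift k a).
Proof. intros I i j H. apply I. lia. Qed.

Lemma cnt_attains (A : nat -> bool) (D t : nat) :
  D <= cnt A t -> exists t', t' <= t /\ cnt A t' = D.
Proof.
  induction t as [|t IH]; intros H.
  - exists 0. cbn in *. lia.
  - destruct (Nat.eq_dec (cnt A (S t)) D) as [E|E]; [eauto|].
    rewrite cnt_S in *. pose proof (ind_le_1 A (S t)).
    destruct IH as (t' & H1 & H2); [lia|]. exists t'. lia.
Qed.

(** * Intervals of subset sums *)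

Lemma in_subset_sums_0 (P : nat -> bool) (a : nat -> nat) : in_subset_sums P a 0.
Proof. exists []. repeat split; easy || constructor. Qed.

Lemma in_subset_sums_incl (P P' : nat -> bool) (a : nat -> nat) (m : nat) :
  (forall j, 1 <= j -> P j = true -> P' j = true) -> in_subset_sums P a m -> in_subset_sums P' a m.
Proof.
  intros H (F & N & HF & E). exists F. repeat split; [easy| | |easy].
  - now apply HF.
  - now apply H; apply HF.
Qed.

Lemma in_subset_sums_add (P1 P2 P : nat -> bool) (a : nat -> nat) (m1 m2 : nat) :
  (forall j, 1 <= j -> P1 j = true -> P j = true) ->
  (forall j, 1 <= j -> P2 j = true -> P j = true /\ P1 j = false) ->
  in_subset_sums P1 a m1 -> in_subset_sums P2 a m2 -> in_subset_sums P a (m1 + m2).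
Proof.
  intros H1 H2 (F1 & N1 & HF1 & E1) (F2 & N2 & HF2 & E2). exists (F1 ++ F2). repeat split.
  - apply NoDup_app; [easy|easy|]. intros j J1 J2.
    apply HF1 in J1. apply HF2 in J2. destruct (H2 j) as [_ C]; [easy|easy|].
    destruct J1 as [_ J1]. congruence.
  - apply in_app_or in H as [H|H]; [now apply HF1|now apply HF2].
  - apply in_app_or in H as [H|H].
    + apply HF1 in H as [Hk H]. now apply H1.
    + apply HF2 in H as [Hk H]. now apply H2.
  - rewrite map_app, fold_right_app, <- E2, E1.
    generalize (map a F1). induction l; cbn; lia.
Qed.

Lemma in_subset_sums_single (P : nat -> bool) (a : nat -> nat) (n : nat) :
  1 <= n -> P n = true -> in_subset_sums P a (a n).
Proof.
  intros Hn HP. exists [n]. repeat split; [repeat constructor; easy| | |cbn; lia];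
    destruct H as [<-|[]]; easy.
Qed.

Definition covers (F : nat -> bool) (a : nat -> nat) (u W : nat) : Prop :=
  forall y, u <= y <= u + W -> in_subset_sums F a y.

(** The interval shifted by [x] and the one shifted by [x + d] overlap or are adjacent when
    [d <= W + 1], so their union is an interval. *)
Lemma covers_switch (F T F' : nat -> bool) (a : nat -> nat) (u W x d : nat) :
  (forall j, 1 <= j -> F j = true -> F' j = true) ->
  (forall j, 1 <= j -> T j = true -> F' j = true /\ F j = false) ->
  covers F a u W -> in_subset_sums T a x -> in_subset_sums T a (x + d) -> d <= W + 1 ->
  covers F' a (u + x) (W + d).
Proof.
  intros H1 H2 C X1 X2 Hd y Hy.
  destruct (Nat.le_gt_cases y (u + x + W)) as [Hc|Hc].
  - replace y with ((y - x) + x) by lia. apply (in_subset_sums_add F T); try easy.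
    apply C. lia.
  - replace y with ((y - x - d) + (x + d)) by lia. apply (in_subset_sums_add F T); try easy.
    apply C. lia.
Qed.

(** Adding the terms of [P] outside [F] in increasing order keeps the left end [u] and lengthens the
    interval by each term. As the lengths are unbounded, every [m >= u] is reached. *)
Lemma complete_of_interval (P F : nat -> bool) (a : nat -> nat) (u W : nat) :
  (forall j, F j = true -> P j = true) -> covers F a u W ->
  (forall n, 1 <= n -> P n = true -> F n = false ->
     a n <= W + psum (sel (minus P F) a) (n - 1)) ->
  (forall B, exists n, B <= psum (sel (minus P F) a) n) ->
  complete_sub P a.
Proof.
  intros HF C Hstep Hunb. exists u. intros m Hm.
  assert (A : forall n, covers (fun j => orb (F j) (andb (P j) (j <=? n))) a u
                          (W + psum (sel (minus P F) a) n)).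
  { induction n as [|n IH].
    - cbn. rewrite Nat.add_0_r. intros y Hy. specialize (C y Hy).
      revert C. apply in_subset_sums_incl. intros j _ ->. easy.
    - rewrite psum_S. unfold sel at 2, minus at 2.
      destruct (P (S n)) eqn:EP; [destruct (F (S n)) eqn:EF|]; cbn [andb negb].
      (* The new term is a switch from 0 to [a (S n)], so the left end does not move. *)
      2:{ rewrite Nat.add_assoc, <- (Nat.add_0_r u).
          apply (covers_switch (fun j => orb (F j) (andb (P j) (j <=? n))) (Nat.eqb (S n))).
          - intros j _ H. apply Bool.orb_true_iff in H as [->|H]; [easy|].
            apply andb_prop in H as [-> H]. apply Nat.leb_le in H.
            apply Bool.orb_true_iff. right. apply Nat.leb_le. lia.
          - intros j _ H. apply Nat.eqb_eq in H as <-. rewrite EP, EF.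
            split; [cbn; apply Nat.leb_refl|]. cbn [orb andb]. apply Nat.leb_gt. lia.
          - exact IH.
          - apply in_subset_sums_0.
          - rewrite Nat.add_0_l. apply in_subset_sums_single; [lia|apply Nat.eqb_refl].
          - specialize (Hstep (S n) ltac:(lia) EP EF).
            replace (S n - 1) with n in Hstep by lia. lia. }
      all: rewrite Nat.add_0_r; intros y Hy; specialize (IH y Hy); revert IH;
        apply in_subset_sums_incl; intros j _ H; apply Bool.orb_true_iff in H as [->|H]; [easy|];
        apply andb_prop in H as [-> H]; apply Nat.leb_le in H;
        apply Bool.orb_true_iff; right; apply Nat.leb_le; lia. }
  destruct (Hunb m) as (n & Hn). specialize (A n m ltac:(lia)). revert A.
  apply in_subset_sums_incl. intros j _ H. apply Bool.orb_true_iff in H as [H|H]; [now apply HF|].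
  now apply andb_prop in H.
Qed.

(** * Terms dominated by their predecessors *)

Definition within (F P : nat -> bool) (l : nat) : Prop :=
  forall j, F j = true -> P j = true /\ 1 <= j <= l.

(** Division-free form of a lower bound on growth: [a y - a x] contains [y - x - 1] gaps of [b],
    each at least [a r / (kap * (r + 1))], since later gaps are not much smaller than the average
    gap before [r]. *)
Definition steep (kap n0 : nat) (a : nat -> nat) : Prop :=
  forall r x y, n0 <= x -> 1 <= r <= x -> x < y ->
    (y - x - 1) * a r <= kap * (r + 1) * (a y - a x).

Lemma cnt_minus_within (F P : nat -> bool) (l n : nat) :
  within F P l -> cnt P n <= cnt (minus P F) n + cnt F l.
Proof.
  intros H. pose proof (cnt_minus P F n (fun j Hj => proj1 (H j Hj))).
  pose proof (cnt_bounded F l n (fun j Hj => proj2 (H j Hj))). lia.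
Qed.

Lemma enough_many (P F : nat -> bool) (a : nat -> nat) (l n k : nat) :
  increasing a -> within F P l -> cnt F l + k <= cnt P n ->
  psum a k <= psum (sel (minus P F) a) n.
Proof.
  intros I H Hc. pose proof (cnt_minus_within F P l n H).
  etransitivity; [|apply psum_sel_lower, I]. apply psum_mono. lia.
Qed.

Lemma psum_shift_le (a : nat -> nat) (x r c : nat) :
  increasing a -> x + r <= c -> psum (shift x a) r <= r * a c.
Proof.
  intros I H. rewrite <- psum_const. apply psum_le. intros j Hj. unfold shift.
  apply increasing_le; [easy|lia].
Qed.

Lemma psum_shift_mono (a : nat -> nat) (x y r : nat) :
  increasing a -> x <= y -> psum (shift x a) r <= psum (shift y a) r.
Proof.
  intros I H. apply psum_le. intros j Hj. unfold shift. apply increasing_le; [easy|lia].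
Qed.

Lemma psum_shift_add (a : nat -> nat) (x q r : nat) :
  psum (shift x a) (q + r) = psum (shift x a) q + psum (shift (x + q) a) r.
Proof.
  rewrite psum_add. f_equal. apply psum_ext. intros j _. unfold shift. f_equal. lia.
Qed.

Lemma psum_split (a : nat -> nat) (k r : nat) :
  psum a (k + r) = psum a k + psum (shift k a) r.
Proof. apply psum_add. Qed.

(** With [s1] elements up to [k] and [s1 + e = k - m], the set [A] has at least [q + e] elements
    beyond [k]: [q] of them outweigh the [q] terms after [k], and [e] of them the terms from
    [s1 + 1] to [k - m]. *)
Lemma psum_sel_two_parts (A : nat -> bool) (a : nat -> nat) (n k m q : nat) :
  increasing a -> k <= n -> m <= k -> cnt A k + m <= k -> k - m + q <= cnt A n ->
  psum a (k - m) + psum (shift k a) q <= psum (sel A a) n.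
Proof.
  intros I Hkn Hm Hk Hn.
  set (s1 := cnt A k) in *. set (e := k - m - s1).
  replace n with (k + (n - k)) in * by lia.
  rewrite cnt_add in Hn. fold s1 in Hn. rewrite psum_add.
  assert (A1 : psum a s1 <= psum (sel A a) k) by now apply psum_sel_lower.
  assert (A2 : psum (shift k a) (q + e) <= psum (sel (shift k A) (shift k a)) (n - k)).
  { etransitivity; [|apply psum_sel_lower, increasing_shift, I]. apply psum_mono. lia. }
  change (psum (fun j => sel A a (k + j)) (n - k))
    with (psum (sel (shift k A) (shift k a)) (n - k)).
  rewrite psum_shift_add in A2.
  replace (k - m) with (s1 + e) by lia. rewrite psum_split.
  pose proof (psum_shift_mono a s1 (k + q) e I ltac:(lia)). lia.
Qed.

Lemma psum_gap_lower (a : nat -> nat) (x y Z A c q : nat) :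
  increasing a -> x <= y ->
  (forall j, 1 <= j <= q -> c < j -> A <= Z * (a (y + j) - a (x + j))) ->
  Z * psum (shift x a) q + (q - c) * A <= Z * psum (shift y a) q.
Proof.
  intros I Hxy. induction q as [|q IH]; intros H; [cbn; lia|].
  specialize (IH ltac:(intros; apply H; lia)). rewrite !psum_S.
  unfold shift at 2 4. pose proof (increasing_le a (x + S q) (y + S q) I ltac:(lia)).
  destruct (Nat.le_gt_cases (S q) c) as [Hc|Hc].
  - replace (S q - c) with 0 by lia. nia.
  - specialize (H (S q) ltac:(lia) Hc). replace (S q - c) with (S (q - c)) by lia. nia.
Qed.

(* Replacing [m - f - 1] of the [m] missing indices by indices beyond [k] gains a fixed
   proportion of [a (k + C0)] each, because [m] is a fixed proportion of [k]. *)
Lemma many_missing_ok (P F : nat -> bool) (a : nat -> nat) (K kap C0 n0 l n k m : nat) :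
  let Z := 4 * K * kap in
  increasing a -> steep kap n0 a -> within F P l ->
  k <= n -> k <= cnt P n + 1 -> m = cnt (compl P) k -> k <= K * m -> 2 <= m ->
  n0 + m <= k -> 1 <= k ->
  (Z + 2) * (cnt F l + 1 + C0) <= m ->
  psum a (k + C0) <= psum (sel (minus P F) a) n.
Proof.
  intros Z I St HF Hkn Hc Hm HK Hm2 Hn0 Hk1 Hbig.
  (* [h] counts the missing indices that find no replacement: one for each element of [F], and one
     because [P] may have only [k - 1] elements up to [n]. *)
  set (h := cnt F l + 1) in *. set (q := m - h).
  assert (HhZ : h <= m) by nia.
  pose proof (cnt_compl P k) as Ck.
  pose proof (cnt_minus P F k (fun j Hj => proj1 (HF j Hj))) as Cm.
  pose proof (cnt_minus_within F P l n HF) as Cn.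
  pose proof (psum_sel_two_parts (minus P F) a n k m q I Hkn ltac:(lia) ltac:(lia) ltac:(lia)) as Low.
  set (A := a (k + C0)) in *.
  assert (Gap : (Z + 1) * psum (shift (k - m) a) q + (q - C0) * A <= (Z + 1) * psum (shift k a) q).
  { apply psum_gap_lower; [easy|lia|]. intros j Hj HjC.
    pose proof (St (k - m + j) (k - m + j) (k + j) ltac:(lia) ltac:(lia) ltac:(lia)) as G.
    replace (k + j - (k - m + j) - 1) with (m - 1) in G by lia.
    pose proof (increasing_le a (k + C0) (k + j) I ltac:(lia)) as G1. fold A in G1.
    set (ax := a (k - m + j)) in *. set (ay := a (k + j)) in *.
    (* Since [k <= K * m], the factor [r + 1] in [steep] is at most [4 * K * (m - 1)]. *)
    assert (G2 : ax <= Z * (ay - ax)).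
    { apply Nat.mul_le_mono_pos_l with (p := m - 1); [lia|].
      etransitivity; [exact G|]. unfold Z.
      replace ((m - 1) * (4 * K * kap * (ay - ax))) with (kap * (4 * K * (m - 1)) * (ay - ax)) by ring.
      apply Nat.mul_le_mono_r, Nat.mul_le_mono_l.
      assert (K * m <= K * (2 * (m - 1))) by (apply Nat.mul_le_mono_l; lia). lia. }
    rewrite Nat.mul_add_distr_r. lia. }
  (* The first two parts are covered by [Low] after moving [q] indices up by [m]; the other [h + C0]
     terms, each at most [A], are paid from the gain of this move. *)
  assert (Split : psum a (k + C0) = psum a (k - m) + psum (shift (k - m) a) q
            + psum (shift (k - m + q) a) h + psum (shift k a) C0).
  { rewrite psum_split. replace (psum a k) with (psum a (k - m + (q + h))) by (f_equal; lia).
    rewrite psum_split, psum_shift_add. lia. }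
  pose proof (psum_shift_le a (k - m + q) h (k + C0) I ltac:(lia)) as U1.
  pose proof (psum_shift_le a k C0 (k + C0) I ltac:(lia)) as U2. fold A in U1, U2.
  assert (Num : (Z + 1) * (h + C0) <= q - C0) by nia.
  assert (Fin : (Z + 1) * psum (shift (k - m) a) q + (Z + 1) * ((h + C0) * A)
                <= (Z + 1) * psum (shift k a) q).
  { etransitivity; [|exact Gap]. apply Nat.add_le_mono_l.
    rewrite Nat.mul_assoc. now apply Nat.mul_le_mono_r. }
  rewrite <- Nat.mul_add_distr_l in Fin. apply Nat.mul_le_mono_pos_l in Fin; lia.
Qed.

(* Here [m] may be tiny compared with [k].  The [C0 + 2] oldest missing indices pay for the
   [C0] extra terms of condition (i); the others pay for [F], whose terms are at most [a l]. *)
Lemma old_missing_ok (P F : nat -> bool) (a : nat -> nat) (K kap C0 n0 l n k m t0 : nat) :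
  let Z := 4 * K * kap in
  let D := C0 + 2 in
  increasing a -> steep kap n0 a -> within F P l ->
  k <= n -> k <= cnt P n + 1 -> m = cnt (compl P) k -> 1 <= l <= k -> l <= K * m ->
  cnt (compl P) t0 = D -> 1 <= t0 <= k -> D * a t0 <= a (k + C0) ->
  n0 + m <= k -> 2 * D + 2 + C0 <= m ->
  (Z + 1) * cnt F l <= m - D ->
  psum a (k + C0) <= psum (sel (minus P F) a) n.
Proof.
  intros Z D I St HF Hkn Hc Hm Hl HlK Ht0 Ht0k Hbig Hn0 HmD Hf.
  set (m1 := m - D) in *. set (A := a (k + C0)) in *. set (f := cnt F l) in *.
  pose proof (cnt_compl P k) as Ck. rewrite <- Hm in Ck.
  assert (Mk : D <= m) by lia.
  (* Up to [k] the loss consists of [F], of the [D] oldest missing terms, each at most [a t0], and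
     of [m1] other missing terms, bounded by the last [m1] terms up to [k]. *)
  assert (Lo : psum a k <= psum (sel (minus P F) a) k + f * a l + D * a t0
                + psum (shift (k - m1) a) m1).
  { rewrite <- (psum_sel_compl P a k), <- (psum_sel_minus P F a k (fun j Hj => proj1 (HF j Hj))).
    assert (B1 : psum (sel F a) k <= f * a l).
    { etransitivity; [apply psum_sel_bounded, (fun j Hj => proj2 (HF j Hj))|].
      apply psum_sel_le_cnt. intros j Hj _. apply increasing_le; [easy|lia]. }
    assert (B2 : psum (sel (compl P) a) k <= D * a t0 + psum (shift (k - m1) a) m1).
    { replace k with (t0 + (k - t0)) at 1 by lia. rewrite psum_add. apply Nat.add_le_mono.
      - rewrite <- Ht0. apply psum_sel_le_cnt. intros j Hj _. apply increasing_le; [easy|lia].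
      - assert (Cs : cnt (shift t0 (compl P)) (k - t0) = m1).
        { pose proof (cnt_add (compl P) t0 (k - t0)) as E.
          replace (t0 + (k - t0)) with k in E by lia. lia. }
        pose proof (psum_sel_upper (shift t0 (compl P)) (shift t0 a) (k - t0)
                      (increasing_shift t0 a I)) as U.
        rewrite Cs in U. etransitivity; [exact U|]. apply psum_le. intros j Hj.
        unfold shift. apply increasing_le; [easy|].
        pose proof (cnt_le (shift t0 (compl P)) (k - t0)). lia. }
    lia. }
  (* Outside [F], [P] has at least [m - 1 = m1 + (C0 + 1)] elements between [k + 1] and [n]. The
     last [C0 + 1] pay for the extra terms of condition (i) and for the [D] oldest missing ones. *)
  assert (Hi : psum (shift k a) m1 + (C0 + 1) * A <=
               psum (shift k (sel (minus P F) a)) (n - k)).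
  { assert (Cs : m - 1 <= cnt (shift k (minus P F)) (n - k)).
    { pose proof (cnt_add (minus P F) k (n - k)) as E.
      replace (k + (n - k)) with n in E by lia.
      pose proof (cnt_minus P F k (fun j Hj => proj1 (HF j Hj))).
      pose proof (cnt_minus_within F P l n HF).
      assert (cnt F l <= cnt F k) by (apply cnt_mono; lia). lia. }
    etransitivity; [|apply (psum_sel_lower (shift k (minus P F)) (shift k a)), increasing_shift, I].
    etransitivity; [|apply psum_mono, Cs].
    replace (m - 1) with (m1 + (C0 + 1)) by lia. rewrite psum_shift_add. apply Nat.add_le_mono_l.
    rewrite <- psum_const. apply psum_le. intros j Hj. unfold shift.
    apply increasing_le; [easy|lia]. }
  assert (Gap : (Z + 1) * psum (shift (k - m1) a) m1 + (m1 - 0) * a l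
                <= (Z + 1) * psum (shift k a) m1).
  { apply psum_gap_lower; [easy|lia|]. intros j Hj _.
    set (x := k - m1 + j).
    (* If [x < l], then [steep] only bounds [a x], and [a l <= a (k + j) = d + a x] turns the factor
       [Z] into [Z + 1]. *)
    pose proof (St (Nat.min l x) x (k + j) ltac:(lia) ltac:(lia) ltac:(lia)) as G.
    replace (k + j - x - 1) with (m1 - 1) in G by lia.
    pose proof (increasing_le a l (k + j) I ltac:(lia)) as G1.
    pose proof (increasing_le a x (k + j) I ltac:(lia)) as G1'.
    set (d := a (k + j) - a x) in *.
    assert (G2 : a (Nat.min l x) <= Z * d).
    { apply Nat.mul_le_mono_pos_l with (p := m1 - 1); [lia|].
      etransitivity; [exact G|]. unfold Z.
      replace ((m1 - 1) * (4 * K * kap * d)) with (kap * (4 * K * (m1 - 1)) * d) by ring.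
      apply Nat.mul_le_mono_r, Nat.mul_le_mono_l.
      assert (K * m <= K * (2 * (m1 - 1))) by (apply Nat.mul_le_mono_l; lia). lia. }
    assert (Ed : a (k + j) = d + a x) by (unfold d; lia).
    rewrite Nat.mul_add_distr_r. destruct (Nat.le_gt_cases l x) as [Hx|Hx].
    - rewrite Nat.min_l in G2 by lia. lia.
    - rewrite Nat.min_r in G2 by lia. lia. }
  assert (Gap' : psum (shift (k - m1) a) m1 + f * a l <= psum (shift k a) m1).
  { apply Nat.mul_le_mono_pos_l with (p := Z + 1); [lia|].
    etransitivity; [|exact Gap]. rewrite Nat.mul_add_distr_l, Nat.sub_0_r.
    apply Nat.add_le_mono_l. rewrite Nat.mul_assoc. now apply Nat.mul_le_mono_r. }
  replace n with (k + (n - k)) by lia. rewrite (psum_split (sel (minus P F) a)).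
  rewrite psum_split. pose proof (psum_shift_le a k C0 (k + C0) I ltac:(lia)) as U2. fold A in U2.
  lia.
Qed.

(** * Choice of the cut-off [l] *)

Lemma least_from (p : nat -> bool) (j : nat) :
  (exists n, j <= n /\ p n = true) ->
  exists n, j <= n /\ p n = true /\ forall i, j <= i < n -> p i = false.
Proof.
  intros (n & Hn & Hp). revert Hn Hp. induction n as [n IH] using lt_wf_ind. intros Hn Hp.
  destruct (existsb p (seq j (n - j))) eqn:E.
  - apply existsb_exists in E as (i & Hi & Hpi). apply in_seq in Hi. apply (IH i); [lia|lia|easy].
  - exists n. repeat split; [easy|easy|]. intros i Hi.
    apply Bool.not_true_iff_false. intros C. rewrite <- Bool.not_true_iff_false in E.
    apply E, existsb_exists. exists i. split; [apply in_seq; lia|easy].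
Qed.

Lemma increasing_ge (a : nat -> nat) (n : nat) : increasing a -> 1 <= a 1 -> 1 <= n -> n <= a n.
Proof.
  intros I H1 Hn. induction n as [|n IH]; [lia|].
  destruct n as [|n]; [lia|]. specialize (I (S n) (S (S n)) ltac:(lia)). lia.
Qed.

Definition dense_from (N : nat) (kk : nat -> nat) (P : nat -> bool) : Prop :=
  forall n, N <= n -> kk n <= cnt P n.

(** What is used about the integer part of [eps * n], in integers; [Q] stands for an integer above
    [1 / eps] and [1 / (1 - eps)]. *)
Record floor_like (Q : nat) (kk : nat -> nat) : Prop := {
  fl_mono : forall m n, m <= n -> kk m <= kk n;
  fl_lower : forall n, n <= Q * (kk n + 1);
  fl_upper : forall n, Q * kk n + n <= Q * n }.

(* Whatever small [F] is set aside below [l], every later term of [P] is at most the sum of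
   the terms of [P] outside [F] that precede it. *)
Definition good_at (P : nat -> bool) (a : nat -> nat) (Y B0 l : nat) : Prop :=
  forall F, within F P l -> Y * cnt F l <= l ->
  forall n, 1 <= n -> P n = true -> l < B0 * n -> a n <= psum (sel (minus P F) a) (n - 1).

(** Fewer than [(1 - 1 / (2 * Q)) * n] elements of [P] precede [n]. *)
Definition sparse (Q : nat) (P : nat -> bool) (n : nat) : bool :=
  n + 2 * Q * cnt P (n - 1) <? 2 * Q * n.

Lemma cnt_pred (P : nat -> bool) (n : nat) : 1 <= n -> cnt P n <= cnt P (n - 1) + 1.
Proof.
  intros H. destruct n as [|n]; [lia|]. rewrite cnt_S. replace (S n - 1) with n by lia.
  pose proof (ind_le_1 P (S n)). lia.
Qed.

(** At least [kk n + n / (2 * Q)] elements of [P] precede [n]; half of the excess over [kk n] covers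
    [F], the other half the constant [C0]. *)
Lemma nonsparse_ok (P F : nat -> bool) (a kk : nat -> nat) (Q C0 Y B0 l n : nat) :
  1 <= Q -> 1 <= B0 -> increasing a -> floor_like Q kk ->
  (forall i, 1 <= i -> a i <= psum a (kk i + C0)) ->
  within F P l -> 4 * Q * B0 <= Y -> Y * cnt F l <= l -> l < B0 * n -> 4 * Q * C0 <= n -> 1 <= n ->
  sparse Q P n = false -> a n <= psum (sel (minus P F) a) (n - 1).
Proof.
  intros HQ HB I FL Hi HF HY Hf Hl Hn Hn1 Hs. apply Nat.ltb_ge in Hs.
  etransitivity; [now apply Hi|]. apply (enough_many P F a l (n - 1)); [easy|easy|].
  pose proof (fl_upper _ _ FL n) as U.
  set (p := cnt P (n - 1)) in *. set (f := cnt F l) in *. set (k := kk n) in *.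
  assert (A : 4 * Q * f < n).
  { apply Nat.mul_lt_mono_pos_l with (p := B0); [lia|].
    eapply Nat.le_lt_trans; [|exact Hl]. etransitivity; [|exact Hf].
    replace (B0 * (4 * Q * f)) with (4 * Q * B0 * f) by ring. now apply Nat.mul_le_mono_r. }
  apply Nat.mul_le_mono_pos_l with (p := 4 * Q); lia.
Qed.

(* Three cases: no [n] is sparse from some point on; a positive proportion of the indices is
   missing from [P] at all scales; or [P] is nearly full up to some large [j], and then [l] is
   chosen from the first sparse [ns >= j], at most [ks = kk ns] and at most [K] times the number
   of indices missing up to [ks]. *)
Lemma good_at_exists (P : nat -> bool) (a kk : nat -> nat) (Q kap C0 n0 B0 N : nat) :
  let K := 16 * Q * Q * B0 in
  let Y := 4 * B0 * Q * K * (4 * K * kap + 2) in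
  1 <= Q -> 1 <= B0 -> increasing a -> 1 <= a 1 -> steep kap n0 a -> floor_like Q kk ->
  (forall i, 1 <= i -> a i <= psum a (kk i + C0)) -> dense_from N kk P ->
  forall l1, exists l, l1 <= l /\ good_at P a Y B0 l.
Proof.
  intros K Y HQ HB I Ha1 St FL Hi HP l1.
  assert (HK : 1 <= K) by (unfold K; nia).
  set (Z := 4 * K * kap) in *.
  assert (HY : 4 * Q * B0 <= Y).
  { unfold Y. replace (4 * Q * B0) with (4 * B0 * Q * 1) by ring.
    rewrite <- (Nat.mul_assoc (4 * B0 * Q)). apply Nat.mul_le_mono_l. nia. }
  destruct (classic (exists n1, forall n, n1 <= n -> sparse Q P n = false)) as [[n1 HN]|HN].
  { exists (l1 + B0 * (n1 + 4 * Q * C0 + 1)). split; [lia|].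
    intros F HF Hf n Hn _ Hl.
    assert (n1 + 4 * Q * C0 + 1 <= n) by (apply Nat.lt_le_incl, Nat.mul_lt_mono_pos_l with (p := B0); lia).
    apply (nonsparse_ok P F a kk Q C0 Y B0 (l1 + B0 * (n1 + 4 * Q * C0 + 1)) n); try easy; [lia|].
    apply HN. lia. }
  assert (Hfull : forall k, Q * (n0 + 1) <= k -> N <= k -> n0 + cnt (compl P) k <= k).
  { intros k H1 H2. pose proof (cnt_compl P k). pose proof (HP k H2).
    pose proof (fl_lower _ _ FL k). enough (n0 <= kk k) by lia. nia. }
  assert (Hkn : forall n, 1 <= n -> kk n <= n - 1).
  { intros n Hn. pose proof (fl_upper _ _ FL n). nia. }
  destruct (classic (exists j0, forall j, j0 <= j -> j <= K * cnt (compl P) j)) as [[j0 HU]|HU].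
  { set (kmin := j0 + N + Q * (n0 + 1) + 2 * (K * ((Z + 2) * (1 + C0)))).
    exists (l1 + B0 * (Q * (kmin + 1) + N)). split; [lia|].
    intros F HF Hf n Hn Pn Hl.
    assert (Hn' : Q * (kmin + 1) + N < n) by (apply Nat.mul_lt_mono_pos_l with (p := B0); lia).
    etransitivity; [now apply Hi|].
    pose proof (fl_lower _ _ FL n) as Fn. set (k := kk n) in *.
    assert (Hk : kmin < k) by nia.
    pose proof (HU k ltac:(lia)) as Hm.
    assert (Hm2 : 2 * ((Z + 2) * (1 + C0)) <= cnt (compl P) k).
    { apply Nat.mul_le_mono_pos_l with (p := K); [lia|]. etransitivity; [|exact Hm]. lia. }
    apply (many_missing_ok P F a K kap C0 n0 (l1 + B0 * (Q * (kmin + 1) + N)) (n - 1) k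
             (cnt (compl P) k)); try easy.
    - now apply Hkn.
    - pose proof (HP n ltac:(lia)). pose proof (cnt_pred P n Hn). fold k in H. lia.
    - assert (1 <= (Z + 2) * (1 + C0)) by (apply (Nat.mul_le_mono 1 _ 1); lia). lia.
    - apply Hfull; lia.
    - lia.
    - fold Z. set (f := cnt F _) in *.
      assert (Hf2 : 2 * ((Z + 2) * f) <= cnt (compl P) k).
      { apply Nat.mul_le_mono_pos_l with (p := 2 * B0 * Q * K); [nia|].
        replace (2 * B0 * Q * K * (2 * ((Z + 2) * f))) with (Y * f) by (unfold Y; ring).
        etransitivity; [exact Hf|]. etransitivity; [apply Nat.lt_le_incl, Hl|].
        replace (2 * B0 * Q * K * cnt (compl P) k) with (B0 * (Q * (2 * (K * cnt (compl P) k)))) by ring.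
        apply Nat.mul_le_mono_l. etransitivity; [exact Fn|]. apply Nat.mul_le_mono_l. lia. }
      replace (f + 1 + C0) with (f + (1 + C0)) by lia.
      rewrite Nat.mul_add_distr_l. lia. }
  set (D := C0 + 2).
  set (B1 := 2 * D + 2 + C0 + l1 + B0 * (4 * Q * C0 + 4 * Q + 1)).
  assert (Hsp : forall n1, exists n, n1 <= n /\ sparse Q P n = true).
  { intros n1. apply NNPP. intros C. apply HN. exists n1. intros n Hn.
    apply Bool.not_true_iff_false. intros E. apply C. eauto. }
  (* A sparse index far out provides at least [B1] missing indices up to a fixed [t], so the [D]
     oldest ones are bounded before [j] and [l] are chosen. *)
  destruct (Hsp (2 * Q * (B1 + 1) + 1)) as (n' & Hn' & Sn').
  set (t := n' - 1).
  assert (Mt : B1 <= cnt (compl P) t).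
  { apply Nat.ltb_lt in Sn'. fold t in Sn'. pose proof (cnt_compl P t).
    assert (2 * Q * (B1 + 1) < 2 * Q * (cnt (compl P) t + 1)).
    { replace n' with (t + 1) in * by lia. nia. }
    enough (B1 + 1 < cnt (compl P) t + 1) by lia.
    now apply Nat.mul_lt_mono_pos_l with (p := 2 * Q); [lia|]. }
  destruct (cnt_attains (compl P) D t) as (t0 & Ht0 & Et0); [lia|].
  assert (Ht0' : 1 <= t0) by (destruct t0; [cbn in Et0; lia|lia]).
  set (kmin := t + N + Q * (n0 + 1) + D * a t0 + l1 + B0 * (4 * Q * C0 + 4 * Q + 1)).
  assert (HV : exists j, Q * (kmin + 1) + N + 1 <= j /\ K * cnt (compl P) j < j).
  { apply NNPP. intros C. apply HU. exists (Q * (kmin + 1) + N + 1). intros j Hj.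
    apply Nat.nlt_ge. intros E. apply C. eauto. }
  destruct HV as (j & Hj & Mj).
  destruct (least_from (sparse Q P) j (Hsp j)) as (ns & Hns & Sns & Min).
  set (ks := kk ns). set (m := cnt (compl P) ks).
  assert (Hks : kmin <= ks).
  { pose proof (fl_lower _ _ FL ns) as A. fold ks in A.
    enough (kmin + 1 <= ks + 1) by lia.
    apply Nat.mul_le_mono_pos_l with (p := Q); lia. }
  assert (Hm : B1 <= m) by (etransitivity; [exact Mt|]; apply cnt_mono; lia).
  (* [old_missing_ok] requires [l] to be at most [k] and [K] times the number of missing indices;
     the latter makes [F] small compared with [m]. *)
  set (l := Nat.min ks (K * m)). exists l.
  assert (HlB : l1 + B0 * (4 * Q * C0 + 4 * Q + 1) <= l).
  { apply Nat.min_glb; [lia|]. transitivity (1 * m); [lia|]. apply Nat.mul_le_mono_r. lia. }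
  split; [lia|].
  intros F HF Hf n Hn Pn Hl.
  assert (Hnbig : 4 * Q * C0 + 4 * Q + 1 < n) by (apply Nat.mul_lt_mono_pos_l with (p := B0); lia).
  destruct (Nat.le_gt_cases ns n) as [Hc|Hc].
  - etransitivity; [now apply Hi|].
    pose proof (fl_mono _ _ FL ns n Hc) as Hk. fold ks in Hk. set (k := kk n) in *.
    assert (Hm' : m <= cnt (compl P) k) by (now apply cnt_mono).
    apply (old_missing_ok P F a K kap C0 n0 l (n - 1) k (cnt (compl P) k) t0); try easy.
    + now apply Hkn.
    + pose proof (HP n ltac:(lia)). pose proof (cnt_pred P n Hn). fold k in H. lia.
    + lia.
    + transitivity (K * m); [lia|]. now apply Nat.mul_le_mono_l.
    + lia.
    + transitivity (k + C0); [fold D; lia|]. apply increasing_ge; [easy|easy|lia].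
    + apply Hfull; lia.
    + fold D. lia.
    + fold Z D. set (f := cnt F l) in *. set (m' := cnt (compl P) k) in *.
      enough (2 * ((Z + 1) * f) <= m') by lia.
      apply Nat.mul_le_mono_pos_l with (p := K); [lia|].
      transitivity (K * m); [|now apply Nat.mul_le_mono_l].
      transitivity l; [|lia]. etransitivity; [|exact Hf].
      unfold Y. replace (K * (2 * ((Z + 1) * f))) with (2 * K * (Z + 1) * f) by ring.
      apply Nat.mul_le_mono_r. fold Z.
      replace (4 * B0 * Q * K * (Z + 2)) with (2 * K * (Z + 2) * (2 * (B0 * Q))) by ring.
      assert (1 <= B0 * Q) by (apply (Nat.mul_le_mono 1 B0 1 Q); lia).
      transitivity (2 * K * (Z + 2) * 1); [|apply Nat.mul_le_mono_l; lia].
      rewrite Nat.mul_1_r. apply Nat.mul_le_mono_l. lia.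
  (* For [n < ns] the index is not sparse: from [j] on by minimality of [ns], before [j] because few
     indices are missing up to [n]. *)
  - apply (nonsparse_ok P F a kk Q C0 Y B0 l n); try easy; [lia|].
    destruct (Nat.le_gt_cases j n) as [Hjn|Hjn]; [apply Min; lia|].
    apply Nat.ltb_ge.
    enough (A : 16 * Q * cnt (compl P) n <= n).
    { pose proof (cnt_compl P n). pose proof (cnt_pred P n Hn).
      assert (2 * Q * n <= 2 * Q * (cnt P (n - 1) + 1 + cnt (compl P) n))
        by (apply Nat.mul_le_mono_l; lia). lia. }
    (* If [l = K * m] and [n <= ks], at most [m = l / K] indices are missing up to [n], and
       [l < B0 * n]. Otherwise [j <= ns <= Q * (ks + 1) <= Q * B0 * n], and fewer than [j / K] are
       missing up to [j]. *)
    destruct (Nat.le_gt_cases (K * m) ks) as [Hlm|Hlm];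
      [destruct (Nat.le_gt_cases n ks) as [Hnk|Hnk]|].
    + assert (M : cnt (compl P) n <= m) by now apply cnt_mono.
      assert (E : l = K * m) by (unfold l; lia). rewrite E in Hl. unfold K in Hl.
      enough (16 * Q * m < n) by (eapply Nat.le_trans; [apply Nat.mul_le_mono_l, M|lia]).
      apply Nat.mul_lt_mono_pos_l with (p := B0); [lia|]. eapply Nat.le_lt_trans; [|exact Hl].
      replace (16 * Q * Q * B0 * m) with (B0 * (16 * Q * m) * Q) by ring.
      transitivity (B0 * (16 * Q * m) * 1); [lia|]. apply Nat.mul_le_mono_l. lia.
    + assert (M : cnt (compl P) n <= cnt (compl P) j) by (apply cnt_mono; lia).
      assert (J : j <= Q * (B0 * n)).
      { pose proof (fl_lower _ _ FL ns) as A. fold ks in A. 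
        transitivity ns; [easy|]. etransitivity; [exact A|]. apply Nat.mul_le_mono_l.
        transitivity (1 * n); [lia|]. apply Nat.mul_le_mono_r. lia. }
      enough (16 * Q * cnt (compl P) j < n) by (eapply Nat.le_trans; [apply Nat.mul_le_mono_l, M|lia]).
      apply Nat.mul_lt_mono_pos_l with (p := Q * B0); [apply Nat.mul_pos_pos; lia|].
      eapply Nat.le_lt_trans; [|eapply Nat.lt_le_trans; [exact Mj|lia]].
      unfold K. lia.
    + assert (M : cnt (compl P) n <= cnt (compl P) j) by (apply cnt_mono; lia).
      assert (J : j <= Q * (B0 * n)).
      { pose proof (fl_lower _ _ FL ns) as A. fold ks in A.
        transitivity ns; [easy|]. etransitivity; [exact A|]. apply Nat.mul_le_mono_l. lia. }
      enough (16 * Q * cnt (compl P) j < n) by (eapply Nat.le_trans; [apply Nat.mul_le_mono_l, M|lia]).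
      apply Nat.mul_lt_mono_pos_l with (p := Q * B0); [apply Nat.mul_pos_pos; lia|].
      eapply Nat.le_lt_trans; [|eapply Nat.lt_le_trans; [exact Mj|lia]].
      unfold K. lia.
Qed.

(** Terms with [B0 * n <= l] are at most [W], later ones are dominated by their predecessors.
    Intervals are asked for at all large [l] because [good_at] is available only at some arbitrarily
    large [l]. *)
Lemma complete_of_intervals (P : nat -> bool) (a kk : nat -> nat) (Q kap C0 n0 B0 N : nat) :
  let K := 16 * Q * Q * B0 in
  let Y := 4 * B0 * Q * K * (4 * K * kap + 2) in
  1 <= Q -> 1 <= B0 -> increasing a -> 1 <= a 1 -> steep kap n0 a -> floor_like Q kk ->
  (forall i, 1 <= i -> a i <= psum a (kk i + C0)) -> dense_from N kk P ->
  (exists l0, forall l, l0 <= l -> exists F u W, within F P l /\ Y * cnt F l <= l /\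
     covers F a u W /\ forall n, 1 <= n -> B0 * n <= l -> a n <= W) ->
  complete_sub P a.
Proof.
  intros K Y HQ HB I Ha1 St FL Hi HP (l0 & HF).
  destruct (good_at_exists P a kk Q kap C0 n0 B0 N HQ HB I Ha1 St FL Hi HP l0) as (l & Hl & Good).
  destruct (HF l Hl) as (F & u & W & HFP & HFY & HC & HW).
  apply (complete_of_interval P F a u W).
  - intros j Hj. now apply HFP.
  - exact HC.
  - intros n Hn Pn Fn. destruct (Nat.le_gt_cases (B0 * n) l) as [H|H].
    + specialize (HW n Hn H). lia.
    + specialize (Good F HFP HFY n Hn Pn H). lia.
  - intros B. exists (N + Q * (B + cnt F l + 1)).
    set (n := N + Q * (B + cnt F l + 1)).
    pose proof (cnt_minus_within F P l n HFP). pose proof (HP n ltac:(lia)).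
    pose proof (fl_lower _ _ FL n).
    assert (B + cnt F l <= kk n) by (unfold n in *; nia).
    transitivity (cnt (minus P F) n); [lia|]. apply psum_le. intros j Hj.
    unfold ind, sel. destruct (minus P F j); [|lia].
    pose proof (increasing_ge a j I Ha1). lia.
Qed.

(** * The sequence *)

(** Friendliness without condition (i), in integers: [kap] replaces [1 / c], and the last two fields
    are the form in which condition (iii) is used. *)
Record regular (kap : nat) (b : nat -> nat) : Prop := {
  reg_inc : increasing b;
  reg_pos : 1 <= b 1;
  reg_kap : 1 <= kap;
  reg_lo : forall i j, 1 <= i <= j -> Delta b i <= kap * Delta b j;
  reg_hi : forall i j, 1 <= i <= j -> b j < 2 * b i -> Delta b j <= kap * Delta b i;
  reg_inf : forall M, exists N, forall n, N <= n -> M <= Delta b n;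
  reg_small : forall C, exists N, forall n, N <= n ->
    C * (Nat.log2 (b n) + 1) * Delta b n <= b n;
  reg_log : forall C, exists N, forall n, N <= n ->
    C * (Nat.log2 (b n) + 1) * (Nat.log2 (b n) + 1) <= n }.

Lemma Delta_spec (b : nat -> nat) (n : nat) : increasing b -> 1 <= n -> b (S n) = b n + Delta b n.
Proof. intros I H. unfold Delta. pose proof (I n (S n) ltac:(lia)). lia. Qed.

Lemma linear_lt_pow2 (c y : nat) : 2 * c + 2 <= y -> c * y < 2 ^ y.
Proof.
  intros H. induction H as [|y H IH].
  - replace (2 * c + 2) with (c + (c + 1) + 1) at 2 by lia. rewrite !Nat.pow_add_r.
    pose proof (Nat.pow_gt_lin_r 2 c ltac:(lia)).
    pose proof (Nat.pow_gt_lin_r 2 (c + 1) ltac:(lia)) as H1. rewrite Nat.pow_add_r in H1.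
    replace (c * (2 * c + 2)) with (c * (c + 1) * 2) by ring.
    change (2 ^ 1) with 2 in *. apply Nat.mul_lt_mono_pos_r; [lia|].
    apply Nat.mul_lt_mono; lia.
  - rewrite Nat.pow_succ_r'. nia.
Qed.

(** The parameter [z] of [interval_choice], making [2 ^ z] exceed every subset sum of the block at
    [e]. The factor [R0] lets the block be cut into windows of [R0] indices. *)
Definition wid (b : nat -> nat) (Q R0 e : nat) : nat :=
  R0 * (2 * Nat.log2 (b e) + (384 * Q + 2)).
Definition len (b : nat -> nat) (Q R0 e : nat) : nat := 16 * Q * wid b Q R0 e.

Fixpoint starts (L : nat -> nat) (n0 m : nat) : nat :=
  match m with 0 => n0 | S m' => starts L n0 m' + L (starts L n0 m') end.

(* The start of the block containing [n0 + i]. *)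
Fixpoint owner (L : nat -> nat) (n0 i : nat) : nat :=
  match i with
  | 0 => n0
  | S i' => let e := owner L n0 i' in if n0 + S i' <? e + L e then e else n0 + S i'
  end.

Lemma starts_ge (L : nat -> nat) (n0 m : nat) : n0 <= starts L n0 m.
Proof. induction m; cbn; lia. Qed.

Lemma owner_starts (L : nat -> nat) (n0 i m : nat) :
  (forall e, 1 <= L e) ->
  starts L n0 m <= n0 + i < starts L n0 m + L (starts L n0 m) ->
  owner L n0 i = starts L n0 m.
Proof.
  intros HL. revert m. induction i as [|i IH]; intros m H; cbn [owner]; cbv zeta.
  - destruct m as [|m]; [easy|]. cbn in H. pose proof (starts_ge L n0 m).
    pose proof (HL (starts L n0 m)). lia.
  - destruct (Nat.eq_dec (starts L n0 m) (n0 + S i)) as [E|E].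
    + destruct m as [|m]; [cbn in E; lia|]. cbn in E. pose proof (HL (starts L n0 m)).
      rewrite (IH m) by lia. destruct (Nat.ltb_spec (n0 + S i) (starts L n0 m + L (starts L n0 m))); [lia|].
      cbn. lia.
    + rewrite (IH m) by lia.
      destruct (Nat.ltb_spec (n0 + S i) (starts L n0 m + L (starts L n0 m))); [easy|lia].
Qed.

Lemma in_subset_sums_ext (P : nat -> bool) (a a' : nat -> nat) (m : nat) :
  (forall j, P j = true -> a j = a' j) -> in_subset_sums P a m -> in_subset_sums P a' m.
Proof.
  intros H (F & N & HF & E). exists F. repeat split; try easy; try now apply HF.
  rewrite E. f_equal. apply map_ext_in. intros j Hj. apply H. now apply HF.
Qed.

(** Inductively [b] stays below [2 * b e] on the block, so condition (iv) bounds all its gaps by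
    [kap * Delta b e]. *)
Lemma block_growth (kap Q R0 e : nat) (b : nat -> nat) :
  regular kap b -> 1 <= e -> kap * len b Q R0 e * Delta b e < b e ->
  forall i, i <= len b Q R0 e -> b (e + i) <= b e + i * (kap * Delta b e) /\ b (e + i) < 2 * b e.
Proof.
  intros Hr He HL. induction i as [|i IH]; intros Hi.
  - rewrite Nat.add_0_r. pose proof (increasing_ge b e (reg_inc _ _ Hr) (reg_pos _ _ Hr) He). lia.
  - destruct IH as [H1 H2]; [lia|].
    pose proof (reg_hi _ _ Hr e (e + i) ltac:(lia) H2).
    rewrite Nat.add_succ_r, (Delta_spec b (e + i) (reg_inc _ _ Hr) ltac:(lia)).
    assert (A : S i * (kap * Delta b e) <= kap * len b Q R0 e * Delta b e).
    { replace (kap * len b Q R0 e * Delta b e) with (len b Q R0 e * (kap * Delta b e)) by ring.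
      now apply Nat.mul_le_mono_r. }
    lia.
Qed.

(* [E_of Q] is divisible by every [k <= G_of Q]; all terms are chosen congruent to 1 modulo it. *)
Definition lam_of (Q : nat) : nat := 6 ^ (8 * Q).
Definition G_of (Q : nat) : nat := 2 * lam_of Q.
Definition E_of (Q : nat) : nat := fact (G_of Q).

(** The conclusion of [interval_choice] for the block at [e], at all scales up to a fixed proportion
    of the gap there. *)
Definition switchable (kap Q R0 : nat) (a b : nat -> nat) (e : nat) : Prop :=
  forall T, 4 * wid b Q R0 e <= rsum (ind T) e (len b Q R0 e) ->
  forall s, 1 <= s -> kap * (G_of Q * E_of Q) * s <= Delta b e ->
  exists x k, in_subset_sums (restrict T e (len b Q R0 e)) a x /\
    in_subset_sums (restrict T e (len b Q R0 e)) a (x + E_of Q * k) /\ s <= k <= G_of Q * s.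

Lemma E_of_pos (Q : nat) : 1 <= E_of Q.
Proof. apply lt_O_fact. Qed.

Lemma G_of_pos (Q : nat) : 1 <= G_of Q.
Proof.
  unfold G_of, lam_of. pose proof (Nat.pow_nonzero 6 (8 * Q) ltac:(lia)). lia.
Qed.

Lemma block_choice (kap Q R0 e : nat) (b : nat -> nat) :
  regular kap b -> 1 <= Q -> 1 <= R0 -> 1 <= e ->
  kap * len b Q R0 e * Delta b e < b e -> E_of Q <= b e ->
  (forall n, e <= n -> E_of Q <= Delta b n) ->
  exists a : nat -> nat,
    (forall n, e <= n < e + len b Q R0 e ->
       b n <= a n < b (S n) /\ exists w, a n = E_of Q * w + 1) /\
    switchable kap Q R0 a b e.
Proof.
  intros Hr HQ HR He Hgrow HEb HED.
  pose proof (block_growth kap Q R0 e b Hr He Hgrow) as BG.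
  pose proof (reg_inc _ _ Hr) as I. pose proof (reg_kap _ _ Hr) as Hkap.
  set (E := E_of Q) in *. set (G := G_of Q).
  pose proof (E_of_pos Q) as HE. fold E in HE.
  pose proof (G_of_pos Q) as HG. fold G in HG.
  set (L := len b Q R0 e) in *.
  (* The least integer from [b n] on that is 1 modulo [E]; the candidates [base n + E * w] with
     [w < Delta b n / E] stay below [b (S n)]. *)
  set (base := fun n => E * ((b n - 1 + (E - 1)) / E) + 1).
  assert (HD : forall n, e <= n < e + L -> Delta b n <= kap * Delta b e).
  { intros n Hn. apply (reg_hi _ _ Hr); [lia|].
    replace n with (e + (n - e)) by lia. apply BG. lia. }
  assert (Hb : forall n, e <= n < e + L -> b (S n) < 2 * b e).
  { intros n Hn. replace (S n) with (e + (S n - e)) by lia. apply BG. lia. }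
  assert (Hpos : forall n, 1 <= n -> 1 <= b n).
  { intros n Hn. pose proof (increasing_ge b n I (reg_pos _ _ Hr) Hn). lia. }
  assert (Hbase : forall n, 1 <= n -> b n <= base n < b n + E).
  { intros n Hn. unfold base. specialize (Hpos n Hn).
    pose proof (Nat.div_mod (b n - 1 + (E - 1)) E ltac:(lia)).
    pose proof (Nat.mod_upper_bound (b n - 1 + (E - 1)) E ltac:(lia)). lia. }
  set (x := Nat.log2 (b e)).
  assert (Hx : b e < 2 ^ (x + 1)).
  { unfold x. rewrite Nat.add_1_r. apply Nat.log2_spec. specialize (Hpos e He). lia. }
  set (z := wid b Q R0 e).
  assert (Hz : 2 * x + (384 * Q + 2) <= z) by (unfold z, wid; fold x; nia).
  assert (HLz : L = 16 * Q * z) by reflexivity.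
  assert (HkGE : 1 <= kap * (G * E)).
  { apply (Nat.mul_le_mono 1 kap 1 (G * E)); [easy|]. apply (Nat.mul_le_mono 1 G 1 E); easy. }
  assert (HL1 : 1 <= L) by (rewrite HLz; nia).
  destruct (interval_choice Q z E (Delta b e / (kap * (G * E))) e (3 * b e) base
              (fun n => Delta b n / E)) as (a & Ha & Hsw).
  - easy.
  - easy.
  - easy.
  - lia.
  - rewrite <- HLz. intros n Hn. split.
    + change (2 * 6 ^ (8 * Q)) with G.
      apply Nat.div_le_lower_bound; [lia|].
      assert (A : kap * (G * E) * (Delta b e / (kap * (G * E))) <= Delta b e).
      { apply Nat.Div0.mul_div_le. }
      pose proof (reg_lo _ _ Hr e n ltac:(lia)) as B.
      apply Nat.mul_le_mono_pos_l with (p := kap); [lia|].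
      etransitivity; [|exact B]. etransitivity; [|exact A].
      apply Nat.eq_le_incl. ring.
    + apply Nat.div_le_lower_bound; [lia|]. specialize (HED n ltac:(lia)). lia.
  - rewrite <- HLz. intros n Hn. specialize (Hb n Hn). specialize (Hbase n ltac:(lia)).
    pose proof (Nat.Div0.mul_div_le (Delta b n) E).
    rewrite (Delta_spec b n I ltac:(lia)) in Hb. lia.
  - transitivity (Delta b e).
    { apply Nat.Div0.div_le_upper_bound. rewrite <- (Nat.mul_1_l (Delta b e)) at 1.
      now apply Nat.mul_le_mono_r. }
    transitivity (2 * b e).
    { specialize (Hb e ltac:(lia)). rewrite (Delta_spec b e I He) in Hb. lia. }
    transitivity (2 ^ (x + 1 + 1)); [rewrite (Nat.pow_add_r 2 (x + 1)); change (2 ^ 1) with 2; lia|].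
    apply Nat.pow_le_mono_r; lia.
  (* The factor [2 ^ x] accounts for the size of [b e], and [2 ^ (z - x)] for the number of
     terms. *)
  - replace z with (x + (z - x)) at 2 by lia. rewrite Nat.pow_add_r.
    assert (A : 192 * Q * (z - x) < 2 ^ (z - x)) by (apply linear_lt_pow2; lia).
    rewrite Nat.pow_add_r in Hx. change (2 ^ 1) with 2 in Hx.
    assert (B : 16 * Q * z * 6 <= 192 * Q * (z - x)) by nia.
    assert (C : 2 ^ x * (192 * Q * (z - x)) < 2 ^ x * 2 ^ (z - x)).
    { apply Nat.mul_lt_mono_pos_l; [|easy]. apply Nat.neq_0_lt_0, Nat.pow_nonzero. lia. }
    eapply Nat.le_lt_trans; [|exact C].
    transitivity (2 ^ x * (16 * Q * z * 6)); [|now apply Nat.mul_le_mono_l].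
    replace (2 ^ x * (16 * Q * z * 6)) with (16 * Q * z * (3 * (2 ^ x * 2))) by ring.
    apply Nat.mul_le_mono_l. lia.
  - rewrite <- HLz in Ha, Hsw. exists a. split.
    + intros n Hn. destruct (Ha n Hn) as (w & Hw & Eq).
      specialize (Hbase n ltac:(lia)). split.
      * rewrite (Delta_spec b n I ltac:(lia)).
        pose proof (Nat.Div0.mul_div_le (Delta b n) E).
        rewrite Eq. split; [lia|]. nia.
      * exists ((b n - 1 + (E - 1)) / E + w). rewrite Eq. unfold base. ring.
    + intros T HT s Hs1 Hs. apply Hsw; [exact HT|]. split; [easy|].
      apply Nat.div_le_lower_bound; [lia|]. exact Hs.
Qed.

(** The blocks are chosen independently, and each index reads its value from the choice made for its
    own block. Below [n0] the sequence is [b] itself. *)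
Lemma block_sequence (kap Q R0 nx : nat) (b : nat -> nat) :
  regular kap b -> 1 <= Q -> 1 <= R0 ->
  exists n0 a,
    nx <= n0 /\ 1 <= n0 /\
    (forall n, 1 <= n -> b n <= a n < b (S n)) /\
    (forall n, n0 <= n -> exists w, a n = E_of Q * w + 1) /\
    (forall n, n0 <= n -> kap * len b Q R0 n * Delta b n < b n) /\
    forall m, switchable kap Q R0 a b (starts (len b Q R0) n0 m).
Proof.
  intros Hr HQ HR. pose proof (reg_inc _ _ Hr) as I. pose proof (reg_pos _ _ Hr) as Hb1.
  destruct (reg_inf _ _ Hr (E_of Q)) as (N1 & HN1).
  destruct (reg_small _ _ Hr (kap * (16 * Q * (R0 * (384 * Q + 2))) + 1)) as (N2 & HN2).
  set (n0 := 1 + nx + N1 + N2 + E_of Q).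
  assert (HL : forall e, 1 <= len b Q R0 e) by (intros e; unfold len, wid; nia).
  assert (Hsm : forall n, n0 <= n -> kap * len b Q R0 n * Delta b n < b n).
  { intros n Hn. specialize (HN2 n ltac:(lia)). set (x := Nat.log2 (b n)) in *.
    pose proof (increasing_ge b n I Hb1 ltac:(lia)).
    assert (A : kap * len b Q R0 n <= kap * (16 * Q * (R0 * (384 * Q + 2))) * (x + 1)).
    { unfold len, wid. fold x.
      replace (kap * (16 * Q * (R0 * (384 * Q + 2))) * (x + 1))
        with (kap * (16 * Q * (R0 * ((384 * Q + 2) * (x + 1))))) by ring.
      do 3 apply Nat.mul_le_mono_l. nia. }
    assert (B : kap * len b Q R0 n * Delta b n <=
       kap * (16 * Q * (R0 * (384 * Q + 2))) * (x + 1) * Delta b n) by now apply Nat.mul_le_mono_r.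
    assert (D1 : 1 <= Delta b n).
    { pose proof (I n (S n) ltac:(lia)) as D. rewrite (Delta_spec b n I ltac:(lia)) in D. lia. }
    eapply Nat.le_lt_trans; [exact B|]. eapply Nat.lt_le_trans; [|exact HN2].
    set (c := kap * (16 * Q * (R0 * (384 * Q + 2)))). clearbody c x. nia. }
  assert (CH : forall e, exists a : nat -> nat, n0 <= e ->
     (forall n, e <= n < e + len b Q R0 e ->
       b n <= a n < b (S n) /\ exists w, a n = E_of Q * w + 1) /\
     switchable kap Q R0 a b e).
  { intros e. destruct (le_lt_dec n0 e) as [He|He]; [|exists (fun _ => 0); lia].
    destruct (block_choice kap Q R0 e b) as (a & Ha); try easy.
    - lia.
    - now apply Hsm.
    - pose proof (increasing_ge b e I Hb1 ltac:(lia)). lia.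
    - intros n Hn. apply HN1. lia.
    - now exists a. }
  set (val := fun e => proj1_sig (constructive_indefinite_description _ (CH e))).
  assert (Hval : forall e, n0 <= e ->
     (forall n, e <= n < e + len b Q R0 e ->
       b n <= val e n < b (S n) /\ exists w, val e n = E_of Q * w + 1) /\
     switchable kap Q R0 (val e) b e).
  { intros e. unfold val. destruct (constructive_indefinite_description _ (CH e)) as [a Ha]. exact Ha. }
  set (a := fun n => if n <? n0 then b n else val (owner (len b Q R0) n0 (n - n0)) n).
  assert (Hown : forall n, n0 <= n -> exists m, starts (len b Q R0) n0 m <= n <
            starts (len b Q R0) n0 m + len b Q R0 (starts (len b Q R0) n0 m)).
  { intros n Hn. replace n with (n0 + (n - n0)) by lia. generalize (n - n0) as i.
    induction i as [|i (m & IH)].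
    - exists 0. cbn [starts]. pose proof (HL n0). lia.
    - destruct (le_lt_dec (starts (len b Q R0) n0 m + len b Q R0 (starts (len b Q R0) n0 m)) (n0 + S i)).
      + exists (S m). cbn [starts]. pose proof (HL (starts (len b Q R0) n0 m + len b Q R0 (starts (len b Q R0) n0 m))). lia.
      + exists m. lia. }
  assert (Ha : forall m n, starts (len b Q R0) n0 m <= n <
            starts (len b Q R0) n0 m + len b Q R0 (starts (len b Q R0) n0 m) ->
            a n = val (starts (len b Q R0) n0 m) n).
  { intros m n Hn. pose proof (starts_ge (len b Q R0) n0 m). unfold a.
    destruct (Nat.ltb_spec n n0); [lia|].
    rewrite (owner_starts _ _ (n - n0) m HL); [easy|lia]. }
  exists n0, a. split; [lia|]. split; [lia|]. split; [|split; [|split]].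
  - intros n Hn. destruct (le_lt_dec n0 n) as [H|H].
    + destruct (Hown n H) as (m & Hm). rewrite (Ha m n Hm).
      apply Hval; [apply starts_ge|easy].
    + unfold a. destruct (Nat.ltb_spec n n0); [|lia]. split; [easy|]. apply I. lia.
  - intros n Hn. destruct (Hown n Hn) as (m & Hm). rewrite (Ha m n Hm).
    apply Hval with (n := n); [apply starts_ge|easy].
  - exact Hsm.
  - intros m. set (e := starts (len b Q R0) n0 m).
    destruct (Hval e (starts_ge _ _ m)) as [_ Hs].
    intros T HT s Hs1 Hs2. destruct (Hs T HT s Hs1 Hs2) as (x & k & X1 & X2 & Hk).
    assert (Hext : forall y, in_subset_sums (restrict T e (len b Q R0 e)) (val e) y ->
                     in_subset_sums (restrict T e (len b Q R0 e)) a y).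
    { intros y. apply in_subset_sums_ext. intros j Hj. apply restrict_iff in Hj as [_ Hj].
      symmetry. now apply Ha. }
    exists x, k. auto.
Qed.

(** * A first interval of subset sums *)

Record built (kap Q R0 n0 : nat) (a b : nat -> nat) : Prop := {
  bl_reg : regular kap b;
  bl_Q : 1 <= Q;
  bl_R0 : 1 <= R0;
  bl_n0 : 1 <= n0;
  bl_ab : forall n, 1 <= n -> b n <= a n < b (S n);
  bl_mod : forall n, n0 <= n -> exists w, a n = E_of Q * w + 1;
  bl_small : forall n, n0 <= n -> kap * len b Q R0 n * Delta b n < b n;
  bl_D : forall n, n0 <= n -> kap * (G_of Q * E_of Q) <= Delta b n;
  bl_b1 : forall n, n0 <= n -> b 1 <= Delta b n;
  bl_len : forall n, n0 <= n -> len b Q R0 n <= n;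
  bl_sw : forall m, switchable kap Q R0 a b (starts (len b Q R0) n0 m) }.

Definition union (F T : nat -> bool) (j : nat) : bool := orb (F j) (T j).

Lemma cnt_union_le (F T : nat -> bool) (n : nat) : cnt (union F T) n <= cnt F n + cnt T n.
Proof.
  unfold cnt. rewrite <- psum_plus. apply psum_le. intros j _. unfold ind, union.
  destruct (F j), (T j); cbn; lia.
Qed.

Lemma within_union (F T P : nat -> bool) (l : nat) :
  within F P l -> within T P l -> within (union F T) P l.
Proof.
  intros HF HT j Hj. apply Bool.orb_true_iff in Hj as [Hj|Hj]; [now apply HF|now apply HT].
Qed.

Lemma within_le (F P : nat -> bool) (l l' : nat) : l <= l' -> within F P l -> within F P l'.
Proof. intros H HF j Hj. apply HF in Hj as [Hj1 Hj2]. split; [easy|lia]. Qed.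

Lemma in_subset_sums_union (F T : nat -> bool) (a : nat -> nat) (l x y : nat) :
  (forall j, F j = true -> j <= l) -> (forall j, T j = true -> l < j) ->
  in_subset_sums F a x -> in_subset_sums T a y -> in_subset_sums (union F T) a (x + y).
Proof.
  intros HF HT. apply in_subset_sums_add.
  - intros j _ Hj. unfold union. now rewrite Hj.
  - intros j _ Hj. unfold union. rewrite Hj, Bool.orb_true_r. split; [easy|].
    apply Bool.not_true_iff_false. intros C. apply HF in C. apply HT in Hj. lia.
Qed.

Lemma rsum_cnt (P : nat -> bool) (e L : nat) :
  1 <= e -> cnt P (e + L - 1) = cnt P (e - 1) + rsum (ind P) e L.
Proof.
  intros He. induction L as [|L IH]; cbn; [rewrite Nat.add_0_r; lia|].
  replace (e + S L - 1) with (S (e + L - 1)) by lia. rewrite cnt_S, IH.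
  replace (S (e + L - 1)) with (e + L) by lia. lia.
Qed.

Lemma infinite_pigeonhole (R : nat -> nat -> Prop) (G : nat) :
  (forall M, exists m k, M <= m /\ k <= G /\ R m k) ->
  exists k, k <= G /\ forall M, exists m, M <= m /\ R m k.
Proof.
  induction G as [|G IH]; intros H.
  - exists 0. split; [easy|]. intros M. destruct (H M) as (m & k & Hm & Hk & HR).
    exists m. replace 0 with k by lia. easy.
  - destruct (classic (forall M, exists m, M <= m /\ R m (S G))) as [C|C]; [eauto|].
    apply not_all_ex_not in C as (M0 & C).
    destruct IH as (k & Hk & HR); [|eauto].
    intros M. destruct (H (M + M0)) as (m & k & Hm & Hk & HR).
    exists m, k. repeat split; [lia| |easy].
    destruct (Nat.eq_dec k (S G)) as [->|E]; [|lia].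
    exfalso. apply C. exists m. split; [lia|easy].
Qed.

Lemma len_pos (b : nat -> nat) (Q R0 e : nat) : 1 <= Q -> 1 <= R0 -> 1 <= len b Q R0 e.
Proof. intros. unfold len, wid. nia. Qed.

Lemma starts_ge_index (kap Q R0 n0 : nat) (a b : nat -> nat) (m : nat) :
  built kap Q R0 n0 a b -> n0 + m <= starts (len b Q R0) n0 m.
Proof.
  intros B. induction m as [|m IH]; cbn [starts]; [lia|].
  pose proof (len_pos b Q R0 (starts (len b Q R0) n0 m) (bl_Q _ _ _ _ _ _ B) (bl_R0 _ _ _ _ _ _ B)).
  lia.
Qed.

(** Otherwise, from some block on, each contains fewer than [len / (4 * Q)] elements of [P], whose
    density would be at most [1 / (4 * Q)]; but [floor_like] gives at least about [1 / Q]. *)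
Lemma dense_blocks (kap Q R0 n0 N : nat) (a b kk : nat -> nat) (P : nat -> bool) :
  built kap Q R0 n0 a b -> floor_like Q kk -> dense_from N kk P ->
  forall M, exists m, M <= m /\
    4 * wid b Q R0 (starts (len b Q R0) n0 m) <=
    rsum (ind P) (starts (len b Q R0) n0 m) (len b Q R0 (starts (len b Q R0) n0 m)).
Proof.
  intros B FL HP M. apply NNPP. intros C.
  set (es := starts (len b Q R0) n0) in *.
  pose proof (bl_Q _ _ _ _ _ _ B) as HQ. pose proof (bl_n0 _ _ _ _ _ _ B) as Hn0.
  assert (A : forall i, 4 * Q * cnt P (es (M + i) - 1) + es M <= 4 * Q * cnt P (es M - 1) + es (M + i)).
  { induction i as [|i IH]; [rewrite Nat.add_0_r; lia|].
    rewrite Nat.add_succ_r. set (m := M + i) in *.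
    change (es (S m)) with (es m + len b Q R0 (es m)).
    pose proof (starts_ge (len b Q R0) n0 m : n0 <= es m).
    rewrite rsum_cnt by lia.
    assert (D : rsum (ind P) (es m) (len b Q R0 (es m)) < 4 * wid b Q R0 (es m)).
    { apply Nat.nle_gt. intros D. apply C. exists m. split; [lia|easy]. }
    unfold len in *. set (w := wid b Q R0 (es m)) in *. nia. }
  set (c0 := cnt P (es M - 1)) in *.
  specialize (A (4 * Q * c0 + 8 * Q + N + 8)).
  pose proof (starts_ge_index _ _ _ _ _ _ (M + (4 * Q * c0 + 8 * Q + N + 8)) B) as G. fold es in G.
  set (e := es (M + (4 * Q * c0 + 8 * Q + N + 8))) in *.
  pose proof (HP (e - 1) ltac:(lia)). pose proof (fl_lower _ _ FL (e - 1)). nia.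
Qed.

Lemma fact_divides (k n : nat) : 1 <= k <= n -> exists q, fact n = k * q.
Proof.
  intros [Hk Hn]. induction n as [|n IH]; [lia|].
  destruct (Nat.eq_dec k (S n)) as [->|E].
  - exists (fact n). reflexivity.
  - destruct IH as (q & Hq); [lia|]. exists (q * S n). cbn [fact]. rewrite Hq. ring.
Qed.

(** At scale 1 a dense block yields a step [E * k] with [1 <= k <= G]. Some [k] occurs in infinitely
    many blocks, and disjoint blocks with this [k] give a progression of step [E * k]. As [k]
    divides [E], it contains one of step [E * E]. *)
Lemma base_steps (kap Q R0 n0 N : nat) (a b kk : nat -> nat) (P : nat -> bool) :
  built kap Q R0 n0 a b -> floor_like Q kk -> dense_from N kk P ->
  forall t J, exists F u T0, within F P T0 /\ (forall j, F j = true -> t < j) /\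
    forall j, j <= J -> in_subset_sums F a (u + E_of Q * E_of Q * j).
Proof.
  intros B FL HP t J. set (es := starts (len b Q R0) n0) in *.
  set (R := fun m k => 1 <= k /\ exists x,
     in_subset_sums (restrict P (es m) (len b Q R0 (es m))) a x /\
     in_subset_sums (restrict P (es m) (len b Q R0 (es m))) a (x + E_of Q * k)).
  destruct (infinite_pigeonhole R (G_of Q)) as (k & Hk & HR).
  { intros M. destruct (dense_blocks _ _ _ _ _ _ _ _ _ B FL HP M) as (m & Hm & D). fold es in D.
    destruct (bl_sw _ _ _ _ _ _ B m P D 1 ltac:(lia)) as (x & k & X1 & X2 & Hk).
    { rewrite Nat.mul_1_r. apply (bl_D _ _ _ _ _ _ B), starts_ge. }
    rewrite Nat.mul_1_r in Hk. exists m, k. unfold R. repeat split; [easy|easy|easy|]. exists x. now split. }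
  destruct (HR 0) as (_ & _ & Hk1 & _).
  destruct (fact_divides k (G_of Q)) as (q & Hq); [easy|]. fold (E_of Q) in Hq.
  assert (A : forall J', exists F u T0, within F P T0 /\ (forall j, F j = true -> t < j) /\
    forall j, j <= J' -> in_subset_sums F a (u + E_of Q * k * j)).
  { induction J' as [|J' (F & u & T0 & W & Ht & HF)].
    - exists (fun _ => false), 0, 0. repeat split; try easy.
      intros j Hj. replace (0 + E_of Q * k * j) with 0 by nia. apply in_subset_sums_0.
    - destruct (HR (t + T0 + 1)) as (m & Hm & _ & x & X1 & X2).
      pose proof (starts_ge_index _ _ _ _ _ _ m B) as G. fold es in G.
      set (T := restrict P (es m) (len b Q R0 (es m))) in *.
      assert (HT : forall j, T j = true -> P j = true /\ es m <= j < es m + len b Q R0 (es m))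
        by (intros j; apply restrict_iff).
      exists (union F T), (u + x), (es m + len b Q R0 (es m)). split; [|split].
      + apply within_union.
        * apply (within_le _ _ T0); [lia|easy].
        * intros j Hj. apply HT in Hj as [Hj1 Hj2]. split; [easy|lia].
      + intros j Hj. apply Bool.orb_true_iff in Hj as [Hj|Hj]; [now apply Ht|].
        apply HT in Hj. lia.
      + assert (U : forall y y', in_subset_sums F a y -> in_subset_sums T a y' ->
                    in_subset_sums (union F T) a (y + y')).
        { intros y y'. apply (in_subset_sums_union F T a T0).
          - intros j Hj. now apply W.
          - intros j Hj. apply HT in Hj. lia. }
        intros j Hj. destruct (Nat.eq_dec j (S J')) as [->|E].
        * replace (u + x + E_of Q * k * S J') with ((u + E_of Q * k * J') + (x + E_of Q * k)) by ring.
          apply U; [now apply HF|easy].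
        * replace (u + x + E_of Q * k * j) with ((u + E_of Q * k * j) + x) by ring.
          apply U; [apply HF; lia|easy]. }
  destruct (A (q * J)) as (F & u & T0 & W & Ht & HF). exists F, u, T0. repeat split; try easy; try now apply W.
  intros j Hj. replace (E_of Q * E_of Q * j) with (E_of Q * k * (q * j)).
  - apply HF. now apply Nat.mul_le_mono_l.
  - rewrite Hq at 2. ring.
Qed.

(** Infinitely many terms of [P] share one residue [1 + E * t] modulo [E * E], and [j] of them sum
    to its [j]-th multiple. Being a unit, it has all residues among its multiples. *)
Lemma residue_fixers (kap Q R0 n0 N : nat) (a b kk : nat -> nat) (P : nat -> bool) :
  built kap Q R0 n0 a b -> floor_like Q kk -> dense_from N kk P ->
  exists t, forall J, exists F T0 V, within F P T0 /\
    forall j, j <= J -> exists c, j * (1 + E_of Q * t) + E_of Q * E_of Q * c <= V /\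
      in_subset_sums F a (j * (1 + E_of Q * t) + E_of Q * E_of Q * c).
Proof.
  intros B FL HP. set (E := E_of Q). pose proof (E_of_pos Q : 1 <= E) as HE.
  set (R := fun n t => P n = true /\ exists c, a n = 1 + E * t + E * E * c).
  destruct (infinite_pigeonhole R E) as (t & Ht & HR).
  { intros M. pose proof (bl_Q _ _ _ _ _ _ B) as HQ.
    assert (Inf : exists n, M + n0 <= n /\ P n = true).
    { apply NNPP. intros C.
      assert (A : forall i, cnt P (M + n0 + i) <= cnt P (M + n0)).
      { induction i as [|i IH]; [rewrite Nat.add_0_r; lia|].
        rewrite Nat.add_succ_r, cnt_S. unfold ind. destruct (P (S (M + n0 + i))) eqn:EP; [|lia].
        exfalso. apply C. exists (S (M + n0 + i)). split; [lia|easy]. }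
      specialize (A (N + Q * (M + n0 + 2))).
      pose proof (cnt_le P (M + n0)). set (n := M + n0 + (N + Q * (M + n0 + 2))) in *.
      pose proof (HP n ltac:(lia)). pose proof (fl_lower _ _ FL n). unfold n in *. nia. }
    destruct Inf as (n & Hn & Pn). destruct (bl_mod _ _ _ _ _ _ B n ltac:(lia)) as (w & Hw).
    exists n, (w mod E). repeat split; [lia| |easy|].
    - pose proof (Nat.mod_upper_bound w E ltac:(lia)). lia.
    - exists (w / E). rewrite Hw. fold E. rewrite (Nat.div_mod w E) at 1 by lia. ring. }
  exists t. induction J as [|J (F & T0 & V & W & HF)].
  - exists (fun _ => false), 0, 0. split; [easy|]. intros j Hj. exists 0.
    replace (j * (1 + E * t) + E * E * 0) with 0 by nia. split; [easy|]. apply in_subset_sums_0.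
  - destruct (HR (T0 + 1)) as (n & Hn & Pn & c & Hc).
    set (T := Nat.eqb n).
    assert (HT : forall j, T j = true -> j = n) by (intros j Hj; apply Nat.eqb_eq in Hj; easy).
    exists (union F T), n, (V + a n). split.
    + apply within_union.
      * apply (within_le _ _ T0); [lia|easy].
      * intros j Hj. apply HT in Hj as ->. split; [easy|lia].
    + assert (U : forall y y', in_subset_sums F a y -> in_subset_sums T a y' ->
                    in_subset_sums (union F T) a (y + y')).
      { intros y y'. apply (in_subset_sums_union F T a T0).
        - intros j Hj. now apply W.
        - intros j Hj. apply HT in Hj. lia. }
      intros j Hj. destruct (Nat.eq_dec j (S J)) as [->|NE].
      * destruct (HF J ltac:(lia)) as (c' & Hc' & X). exists (c' + c).
        replace (S J * (1 + E * t) + E * E * (c' + c))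
          with ((J * (1 + E * t) + E * E * c') + a n) by (rewrite Hc; ring).
        split; [lia|]. apply U; [easy|]. apply in_subset_sums_single; [lia|apply Nat.eqb_refl].
      * destruct (HF j ltac:(lia)) as (c' & Hc' & X). exists c'. split; [lia|].
        rewrite <- (Nat.add_0_r (j * _ + _)). apply U; [easy|apply in_subset_sums_0].
Qed.

(** A sum [v] congruent to [y - u] modulo [E * E] is completed to [y] by steps [E * E] from later
    blocks. Starting at [u + V] ensures [v <= y - u]. *)
Lemma base_interval (kap Q R0 n0 N : nat) (a b kk : nat -> nat) (P : nat -> bool) :
  built kap Q R0 n0 a b -> floor_like Q kk -> dense_from N kk P ->
  forall W0, exists F T0 u, within F P T0 /\ covers F a u W0.
Proof.
  intros B FL HP W0. set (E := E_of Q). pose proof (E_of_pos Q : 1 <= E) as HE.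
  destruct (residue_fixers _ _ _ _ _ _ _ _ _ B FL HP) as (t & HFix). fold E in HFix.
  destruct (HFix (E * E)) as (F1 & T1 & V & W1 & H1).
  destruct (base_steps _ _ _ _ _ _ _ _ _ B FL HP T1 (V + W0)) as (F2 & u & T2 & W2 & Hgt & H2).
  fold E in H2.
  exists (union F1 F2), (T1 + T2), (u + V). split.
  - apply within_union; [apply (within_le _ _ T1)|apply (within_le _ _ T2)]; easy || lia.
  - intros y Hy. set (c := y - u).
    (* [1 + (E - 1) * E * t] is the inverse of [1 + E * t] modulo [E * E]. *)
    set (j := (c * (1 + (E - 1) * E * t)) mod (E * E)).
    assert (HEE : E * E <> 0) by nia.
    assert (Hj : j <= E * E) by (apply Nat.lt_le_incl, Nat.mod_upper_bound, HEE).
    destruct (H1 j Hj) as (c1 & Hv & X1). set (v := j * (1 + E * t) + E * E * c1) in *.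
    assert (Hmod : v mod (E * E) = c mod (E * E)).
    { unfold v. rewrite (Nat.mul_comm (E * E) c1), Nat.Div0.mod_add. unfold j.
      rewrite Nat.Div0.mul_mod_idemp_l.
      replace (c * (1 + (E - 1) * E * t) * (1 + E * t))
        with (c + c * (t + (E - 1) * t * t) * (E * E)).
      - apply Nat.Div0.mod_add.
      - replace E with (E - 1 + 1) at 2 3 5 6 by lia. ring. }
    assert (Hc : exists i, c = v + E * E * i /\ i <= V + W0).
    { exists (c / (E * E) - v / (E * E)).
      pose proof (Nat.div_mod c (E * E) HEE). pose proof (Nat.div_mod v (E * E) HEE).
      pose proof (Nat.Div0.div_le_mono v c (E * E) ltac:(lia)).
      rewrite Nat.mul_sub_distr_l. split; [lia|].
      assert (c / (E * E) <= c) by (apply Nat.Div0.div_le_upper_bound; nia). lia. }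
    destruct Hc as (i & Ei & Hi).
    replace y with (v + (u + E * E * i)) by lia.
    apply (in_subset_sums_union F1 F2 a T1).
    + intros k Hk. now apply W1.
    + exact Hgt.
    + exact X1.
    + now apply H2.
Qed.

(** * Prolonging the interval *)

Lemma rsum_ind_le (T : nat -> bool) (e L : nat) : rsum (ind T) e L <= L.
Proof.
  induction L as [|L IH]; cbn [rsum]; [lia|]. pose proof (ind_le_1 T (e + L)). lia.
Qed.

Lemma first_last (P : nat -> bool) (s R : nat) :
  1 <= rsum (ind P) s R ->
  exists x y, s <= x <= y /\ y < s + R /\ P x = true /\ P y = true /\
    rsum (ind P) s R <= y - x + 1.
Proof.
  induction R as [|R IH]; cbn [rsum]; [lia|]. unfold ind at 2 4.
  destruct (P (s + R)) eqn:EP; intros H.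
  - destruct (Nat.eq_dec (rsum (ind P) s R) 0) as [Z|Z].
    + exists (s + R), (s + R). repeat split; try easy; lia.
    + destruct IH as (x & y & H1 & H2 & Px & _ & H3); [lia|].
      exists x, (s + R). repeat split; try easy; lia.
  - destruct IH as (x & y & H1 & H2 & Px & Py & H3); [lia|].
    exists x, y. repeat split; try easy; lia.
Qed.

Lemma sum_of_gaps (b : nat -> nat) (x lo hi i : nat) :
  increasing b -> 1 <= x -> (forall n, x <= n < x + i -> lo <= Delta b n <= hi) ->
  b x + i * lo <= b (x + i) <= b x + i * hi.
Proof.
  intros I Hx. induction i as [|i IH]; intros H; [replace (x + 0) with x; lia|].
  specialize (IH ltac:(intros; apply H; lia)).
  rewrite Nat.add_succ_r, (Delta_spec b (x + i) I ltac:(lia)).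
  specialize (H (x + i) ltac:(lia)). nia.
Qed.

(** The two sums are the first and the last term of [P] in the window. Interlacing locates each only
    up to a gap, hence the loss of [2 * lo]. *)
Lemma window_pair (P : nat -> bool) (a b : nat -> nat) (s R lo hi : nat) :
  increasing b -> (forall n, 1 <= n -> b n <= a n < b (S n)) -> 1 <= s ->
  (forall n, s <= n < s + R -> lo <= Delta b n <= hi) ->
  exists T x d, (forall j, T j = true -> P j = true /\ s <= j < s + R) /\
    cnt T (s + R - 1) <= 2 /\ in_subset_sums T a x /\ in_subset_sums T a (x + d) /\
    d <= R * hi /\ lo * rsum (ind P) s R <= d + 2 * lo.
Proof.
  intros I Hab Hs HD.
  destruct (Nat.le_gt_cases (rsum (ind P) s R) 1) as [C|C].
  { exists (fun _ => false), 0, 0. repeat split; try easy; try apply in_subset_sums_0; try lia.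
    - unfold cnt. rewrite (psum_ext _ (fun _ => 0)) by easy. rewrite psum_const. lia.
    - nia. }
  destruct (first_last P s R ltac:(lia)) as (x & y & H1 & H2 & Px & Py & H3).
  pose proof (Hab x ltac:(lia)) as Ax. pose proof (Hab y ltac:(lia)) as Ay.
  pose proof (sum_of_gaps b x lo hi (S y - x) I ltac:(lia) ltac:(intros; apply HD; lia)) as G1.
  pose proof (sum_of_gaps b (S x) lo hi (y - S x) I ltac:(lia) ltac:(intros; apply HD; lia)) as G2.
  replace (x + (S y - x)) with (S y) in G1 by lia. replace (S x + (y - S x)) with y in G2 by lia.
  exists (union (Nat.eqb x) (Nat.eqb y)), (a x), (a y - a x).
  split; [|split; [|split; [|split; [|split]]]].
  - intros j Hj. apply Bool.orb_true_iff in Hj as [Hj|Hj]; apply Nat.eqb_eq in Hj as <-;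
      (split; [easy|lia]).
  - etransitivity; [apply cnt_union_le|].
    assert (A : forall z n, cnt (Nat.eqb z) n <= if z <=? n then 1 else 0).
    { intros z n. induction n as [|n IH]; [cbn; destruct z; lia|]. rewrite cnt_S. unfold ind.
      destruct (Nat.eqb_spec z (S n)), (Nat.leb_spec z n), (Nat.leb_spec z (S n)); lia. }
    pose proof (A x (s + R - 1)). pose proof (A y (s + R - 1)).
    destruct (x <=? s + R - 1), (y <=? s + R - 1); lia.
  - apply in_subset_sums_single; [lia|]. unfold union. now rewrite Nat.eqb_refl.
  - replace (a x + (a y - a x)) with (a y).
    + apply in_subset_sums_single; [lia|]. unfold union. now rewrite Nat.eqb_refl, Bool.orb_true_r.
    + assert (b (S x) <= b y); [|lia]. apply increasing_le; [easy|lia].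
  - assert ((S y - x) * hi <= R * hi) by (apply Nat.mul_le_mono_r; lia). lia.
  - transitivity (lo * (y - S x + 2)); [apply Nat.mul_le_mono_l; lia|]. lia.
Qed.

Definition chain (P F : nat -> bool) (a : nat -> nat) (e u W : nat) : Prop :=
  within F P (e - 1) /\ covers F a u W.

Lemma chain_extend (P F T : nat -> bool) (a : nat -> nat) (e L u W x d : nat) :
  1 <= e -> chain P F a e u W -> (forall j, T j = true -> P j = true /\ e <= j < e + L) ->
  in_subset_sums T a x -> in_subset_sums T a (x + d) -> d <= W + 1 ->
  chain P (union F T) a (e + L) (u + x) (W + d) /\
  cnt (union F T) (e + L - 1) <= cnt F (e - 1) + cnt T (e + L - 1).
Proof.
  intros He [HF HC] HT X1 X2 Hd. split; [split|].
  - apply within_union; [apply (within_le _ _ (e - 1)); [lia|easy]|].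
    intros j Hj. apply HT in Hj as [H1 H2]. split; [easy|lia].
  - apply (covers_switch F T); try easy.
    + intros j _ Hj. unfold union. now rewrite Hj.
    + intros j _ Hj. unfold union. rewrite Hj, Bool.orb_true_r. split; [easy|].
      apply Bool.not_true_iff_false. intros C. apply HF in C. apply HT in Hj. lia.
  - etransitivity; [apply cnt_union_le|]. apply Nat.add_le_mono_r.
    apply cnt_bounded. intros j Hj. now apply HF.
Qed.

Lemma windows_pass (P : nat -> bool) (a b : nat -> nat) (s R lo hi w : nat) (F : nat -> bool) (u W : nat) :
  increasing b -> (forall n, 1 <= n -> b n <= a n < b (S n)) -> 1 <= s ->
  (forall n, s <= n < s + R * w -> lo <= Delta b n <= hi) -> R * hi <= W ->
  chain P F a s u W ->
  exists F' u' W', chain P F' a (s + R * w) u' W' /\ W <= W' /\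
    cnt F' (s + R * w - 1) <= cnt F (s - 1) + 2 * w /\
    lo * cnt P (s + R * w - 1) + W <= lo * cnt P (s - 1) + W' + 2 * w * lo.
Proof.
  intros I Hab Hs. induction w as [|w IH]; intros HD HW HC.
  - exists F, u, W. replace (s + R * 0) with s by lia. split; [exact HC|lia].
  - rewrite Nat.mul_succ_r in HD.
    destruct IH as (F1 & u1 & W1 & C1 & HW1 & Hc1 & Hg1); [intros; apply HD; lia|easy|easy|].
    destruct (window_pair P a b (s + R * w) R lo hi I Hab ltac:(lia))
      as (T & x & d & HT & HcT & X1 & X2 & Hd & Hg); [intros; apply HD; lia|].
    destruct (chain_extend P F1 T a (s + R * w) R u1 W1 x d ltac:(lia) C1 HT X1 X2 ltac:(lia))
      as [C2 Hc2].
    replace (s + R * S w) with (s + R * w + R) by ring.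
    exists (union F1 T), (u1 + x), (W1 + d).
    pose proof (rsum_cnt P (s + R * w) R ltac:(lia)) as E. rewrite E.
    split; [exact C2|lia].
Qed.

(** Bernoulli's inequality gives [(1 + 1 / G) ^ G >= 2], so the exponent [G * (c + 1)] already
    exceeds the bound. *)
Lemma pow_ratio (G r c : nat) : 1 <= G -> (G + 1) ^ r <= 2 ^ c * G ^ r -> r < G * (c + 1).
Proof.
  intros HG H. apply Nat.nle_gt. intros C.
  assert (B : forall n, G * (G + 1) ^ n >= G ^ n * (G + n)).
  { induction n as [|n IH]; [cbn; lia|]. rewrite !Nat.pow_succ_r'.
    assert (E : G ^ n >= 0) by lia. nia. }
  assert (B1 : 2 * G ^ G <= (G + 1) ^ G).
  { specialize (B G). apply Nat.mul_le_mono_pos_l with (p := G); [lia|]. lia. }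
  assert (B2 : 2 ^ (c + 1) * G ^ (G * (c + 1)) <= (G + 1) ^ (G * (c + 1))).
  { rewrite !Nat.pow_mul_r, <- Nat.pow_mul_l. apply Nat.pow_le_mono_l. lia. }
  replace r with (G * (c + 1) + (r - G * (c + 1))) in H by lia.
  rewrite !Nat.pow_add_r in H. rewrite Nat.pow_add_r in B2. change (2 ^ 1) with 2 in B2.
  set (p := G ^ (G * (c + 1))) in *. set (q := (G + 1) ^ (G * (c + 1))) in *.
  assert (P1 : 1 <= G ^ (r - G * (c + 1))) by (apply Nat.neq_0_lt_0, Nat.pow_nonzero; lia).
  assert (P2 : G ^ (r - G * (c + 1)) <= (G + 1) ^ (r - G * (c + 1))) by (apply Nat.pow_le_mono_l; lia).
  assert (P3 : 1 <= p) by (apply Nat.neq_0_lt_0, Nat.pow_nonzero; lia).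
  assert (P4 : 1 <= 2 ^ c) by (apply Nat.neq_0_lt_0, Nat.pow_nonzero; lia).
  set (g := G ^ (r - G * (c + 1))) in *. set (h := (G + 1) ^ (r - G * (c + 1))) in *.
  assert (P5 : 1 <= 2 ^ c * p) by nia. set (y := 2 ^ c) in *.
  assert (Q1 : (2 * (y * p)) * g <= q * h) by (apply Nat.mul_le_mono; lia).
  assert (Q2 : 1 <= y * p * g) by (clear - P1 P5; nia).
  lia.
Qed.

Lemma len_mono (b : nat -> nat) (Q R0 m n : nat) :
  increasing b -> 1 <= m <= n -> len b Q R0 m <= len b Q R0 n.
Proof.
  intros I H. unfold len, wid. do 2 apply Nat.mul_le_mono_l.
  pose proof (Nat.log2_le_mono (b m) (b n) (increasing_le b m n I H)). lia.
Qed.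

(** Invariant of a pass over the blocks. Here [r] counts the blocks used for a switch, each
    multiplying [W] by at least [1 + 1 / (2 * G3)], and [ys] measures the length passed. By the last
    inequality [W] is at least [lo] times the number of elements of [P] met, except for those in
    switched blocks, those in blocks with few elements of [P], and two per window. *)
Lemma blocks_pass (kap Q R0 n0 lo m1 ef f0 : nat) (a b : nat -> nat) (P F0 : nat -> bool) (u0 : nat) :
  let es := starts (len b Q R0) n0 in
  let G3 := R0 * kap * (kap * (G_of Q * E_of Q)) in
  let Cap := R0 * kap * b ef in
  let Lam := len b Q R0 ef in
  built kap Q R0 n0 a b ->
  (forall n, es m1 <= n -> lo <= Delta b n) ->
  chain P F0 a (es m1) u0 G3 -> cnt F0 (es m1 - 1) <= f0 ->
  forall i, es (m1 + i) <= ef ->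
  exists F u W r ys, chain P F a (es (m1 + i)) u W /\ G3 <= W /\
    es (m1 + i) = es m1 + 16 * Q * R0 * ys /\
    (2 * G3 + 1) ^ r <= (2 * G3) ^ r * W /\
    (2 * G3 + 1) ^ r <= 2 * Cap * (2 * G3) ^ r /\
    cnt F (es (m1 + i) - 1) <= f0 + r * Lam + 32 * Q * ys /\
    lo * cnt P (es (m1 + i) - 1) <=
      W + lo * (cnt P (es m1 - 1) + r * Lam + 4 * R0 * ys + 32 * Q * ys).
Proof.
  intros es G3 Cap Lam B Hlo HC0 Hf0.
  pose proof (bl_reg _ _ _ _ _ _ B) as Hr. pose proof (reg_inc _ _ Hr) as I.
  pose proof (reg_kap _ _ Hr) as Hkap. pose proof (bl_Q _ _ _ _ _ _ B) as HQ.
  pose proof (bl_R0 _ _ _ _ _ _ B) as HR0. pose proof (bl_n0 _ _ _ _ _ _ B) as Hn0.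
  pose proof (E_of_pos Q) as HE. pose proof (G_of_pos Q) as HG.
  assert (HG3 : 1 <= G3).
  { unfold G3. rewrite <- !Nat.mul_assoc.
    repeat (apply (Nat.mul_le_mono 1 _ 1); [easy|]). easy. }
  induction i as [|i IH].
  - rewrite Nat.add_0_r. intros Hef. exists F0, u0, G3, 0, 0.
    assert (1 <= Cap).
    { unfold Cap. pose proof (increasing_ge b ef I (reg_pos _ _ Hr)).
      pose proof (starts_ge (len b Q R0) n0 m1 : n0 <= es m1).
      apply (Nat.mul_le_mono 1 (R0 * kap) 1); [apply (Nat.mul_le_mono 1 R0 1); lia|lia]. }
    split; [exact HC0|]. cbn [Nat.pow]. lia.
  - rewrite Nat.add_succ_r. set (m := m1 + i) in *.
    set (e := es m) in *. change (es (S m)) with (e + len b Q R0 e). intros Hef.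
    destruct IH as (F & u & W & r & ys & HC & HW & He & Hr1 & Hr2 & Hc & Hg); [lia|].
    pose proof (starts_ge (len b Q R0) n0 m : n0 <= e) as Hne.
    pose proof (block_growth kap Q R0 e b Hr ltac:(lia) (bl_small _ _ _ _ _ _ B e Hne)) as BG.
    set (y := 2 * Nat.log2 (b e) + (384 * Q + 2)).
    assert (HL : len b Q R0 e = 16 * Q * R0 * y) by (unfold len, wid, y; ring).
    assert (Hwid : wid b Q R0 e = R0 * y) by reflexivity.
    assert (HLam : len b Q R0 e <= Lam) by (apply len_mono; [easy|lia]).
    pose proof (rsum_cnt P e (len b Q R0 e) ltac:(lia)) as EP.
    assert (Ey : e + len b Q R0 e = es m1 + 16 * Q * R0 * (ys + y)) by (rewrite HL, He; ring).
    destruct (Nat.le_gt_cases (4 * wid b Q R0 e) (rsum (ind P) e (len b Q R0 e))) as [Dn|Dn].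
    + destruct (Nat.le_gt_cases (R0 * (kap * Delta b e)) W) as [Hcap|Hcap].
      * (* far above the local gap size: one pair from every window *)
        assert (Hw : len b Q R0 e = R0 * (16 * Q * y)) by (rewrite HL; ring).
        destruct (windows_pass P a b e R0 lo (kap * Delta b e) (16 * Q * y) F u W)
          as (F' & u' & W' & C' & HW' & Hc' & Hg'); try easy.
        -- apply (bl_ab _ _ _ _ _ _ B).
        -- lia.
        -- rewrite <- Hw. intros n Hn. split; [apply Hlo; lia|].
           apply (reg_hi _ _ Hr); [lia|]. replace n with (e + (n - e)) by lia. apply BG. lia.
        -- rewrite <- Hw in *. exists F', u', W', r, (ys + y).
           split; [easy|]. split; [lia|]. split; [easy|].
           split; [etransitivity; [exact Hr1|]; now apply Nat.mul_le_mono_l|].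
           split; [easy|]. split; [lia|]. lia.
      * (* below it: a switch with a proportional step *)
        set (s := W / G3).
        pose proof (Nat.div_mod W G3 ltac:(lia)) as DM.
        pose proof (Nat.mod_upper_bound W G3 ltac:(lia)) as MU. fold s in DM.
        assert (Hs1 : 1 <= s) by (apply Nat.div_le_lower_bound; lia).
        destruct (bl_sw _ _ _ _ _ _ B m P Dn s Hs1) as (x & k & X1 & X2 & Hk).
        (* Since [W] is below [R0 * kap * Delta b e], the constant [G3] makes the scale [W / G3]
           admissible for this block. *)
        { fold es e. apply Nat.mul_le_mono_pos_l with (p := R0 * kap); [nia|].
          transitivity (G3 * s); [unfold G3; apply Nat.eq_le_incl; ring|]. lia. }
        fold es e in X1, X2.
        set (T := restrict P e (len b Q R0 e)) in *.
        assert (Hd : E_of Q * k <= W).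
        { transitivity (E_of Q * (G_of Q * s)); [now apply Nat.mul_le_mono_l|].
          transitivity (G3 * s); [|lia]. unfold G3.
          replace (E_of Q * (G_of Q * s)) with (1 * (1 * (G_of Q * E_of Q)) * s) by ring.
          apply Nat.mul_le_mono_r, Nat.mul_le_mono; [nia|]. now apply Nat.mul_le_mono_r. }
        destruct (chain_extend P F T a e (len b Q R0 e) u W x (E_of Q * k)) as [C' Hc'];
          [lia|easy| |easy|easy|lia|].
        { intros j. apply restrict_iff. }
        exists (union F T), (u + x), (W + E_of Q * k), (S r), (ys + y).
        assert (HcT : cnt T (e + len b Q R0 e - 1) <= Lam).
        { etransitivity; [|exact HLam].
          rewrite (rsum_cnt T e) by lia.
          assert (Z : cnt T (e - 1) = 0).
          { unfold cnt. rewrite (psum_ext _ (fun _ => 0)), psum_const; [lia|].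
            intros j Hj. unfold ind. destruct (T j) eqn:ET; [|easy]. apply restrict_iff in ET. lia. }
          rewrite Z. apply rsum_ind_le. }
        assert (HcP : rsum (ind P) e (len b Q R0 e) <= Lam).
        { etransitivity; [apply rsum_ind_le|exact HLam]. }
        assert (Hstep : (2 * G3 + 1) * W <= 2 * G3 * (W + E_of Q * k)).
        { assert (s <= E_of Q * k) by (transitivity (1 * k); [lia|now apply Nat.mul_le_mono_r]).
          assert (G3 * s <= G3 * (E_of Q * k)) by now apply Nat.mul_le_mono_l.
          assert (G3 * 1 <= G3 * s) by now apply Nat.mul_le_mono_l. lia. }
        assert (HWC : W <= Cap).
        { transitivity (R0 * (kap * Delta b e)); [lia|]. unfold Cap. rewrite <- Nat.mul_assoc.
          do 2 apply Nat.mul_le_mono_l. transitivity (b (S e)).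
          - rewrite (Delta_spec b e I ltac:(lia)). lia.
          - apply increasing_le; [easy|]. rewrite HL in *. pose proof (len_pos b Q R0 e HQ HR0). lia. }
        rewrite !Nat.pow_succ_r'.
        set (p := (2 * G3 + 1) ^ r) in *. set (q := (2 * G3) ^ r) in *.
        split; [easy|]. split; [lia|]. split; [easy|]. split; [|split; [|split]].
        -- transitivity ((2 * G3 + 1) * (q * W)); [now apply Nat.mul_le_mono_l|].
           transitivity (q * ((2 * G3 + 1) * W)); [lia|].
           transitivity (q * (2 * G3 * (W + E_of Q * k))); [now apply Nat.mul_le_mono_l|].
           apply Nat.eq_le_incl. ring.
        -- transitivity ((2 * G3 + 1) * (q * W)); [now apply Nat.mul_le_mono_l|].
           transitivity (4 * G3 * (q * Cap)).
           ++ apply Nat.mul_le_mono; [lia|]. now apply Nat.mul_le_mono_l.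
           ++ apply Nat.eq_le_incl. ring.
        -- lia.
        -- rewrite EP.
           assert (lo * rsum (ind P) e (len b Q R0 e) <= lo * Lam) by now apply Nat.mul_le_mono_l.
           lia.
    (* A block with few elements of [P] is skipped and charged to the term [4 * R0 * ys]. *)
    + exists F, u, W, r, (ys + y). split; [|split; [|split; [|split; [|split; [|split]]]]]; try easy.
      * destruct HC as [H1 H2]. split; [|easy]. apply (within_le _ _ (e - 1)); [lia|easy].
      * etransitivity; [apply (cnt_bounded F (e - 1)); intros j Hj; now apply HC|]. lia.
      * rewrite EP. assert (lo * rsum (ind P) e (len b Q R0 e) <= lo * (4 * (R0 * y)))
          by (apply Nat.mul_le_mono_l; lia). lia.
Qed.

Lemma starts_bracket (kap Q R0 n0 A x : nat) (a b : nat -> nat) :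
  built kap Q R0 n0 a b -> 1 <= A -> A * n0 <= x ->
  exists m, A * starts (len b Q R0) n0 m <= x < A * starts (len b Q R0) n0 (S m).
Proof.
  intros B HA Hx. set (es := starts (len b Q R0) n0).
  destruct (least_from (fun m => x <? A * es (S m)) 0) as (m & _ & H1 & H2).
  - exists x. split; [lia|]. apply Nat.ltb_lt.
    pose proof (starts_ge_index _ _ _ _ _ _ (S x) B) as G. fold es in G.
    apply Nat.lt_le_trans with (1 * es (S x)); [lia|now apply Nat.mul_le_mono_r].
  - apply Nat.ltb_lt in H1. exists m. split; [|exact H1].
    destruct m as [|m]; [exact Hx|]. specialize (H2 m ltac:(lia)). now apply Nat.ltb_ge in H2.
Qed.

Lemma starts_mono (L : nat -> nat) (n0 m i : nat) : starts L n0 m <= starts L n0 (m + i).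
Proof. induction i as [|i IH]; [rewrite Nat.add_0_r|rewrite Nat.add_succ_r; cbn [starts]]; lia. Qed.

(** [b r] is [b 1] plus [r - 1] gaps, each at most [kap * Delta b n] by condition (iv). *)
Lemma term_le_gap (kap r n : nat) (b : nat -> nat) :
  regular kap b -> b 1 <= Delta b n -> 1 <= r <= n -> b r <= r * (kap * Delta b n).
Proof.
  intros Hr Hb Hrn. pose proof (reg_kap _ _ Hr) as Hk.
  destruct Hrn as [H1 H2]. induction r as [|r IH]; [lia|].
  destruct (Nat.eq_dec r 0) as [->|E]; [nia|].
  rewrite (Delta_spec b r (reg_inc _ _ Hr)) by lia. specialize (IH ltac:(lia) ltac:(lia)).
  pose proof (reg_lo _ _ Hr r n ltac:(lia)). lia.
Qed.

(** The pass runs from a block start [e1], of order [e / A0], to the last block start [e <= l + 1],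
    beginning with a fixed interval of length [G3]. Up to [e] there are at least about [e / Q]
    elements of [P], and all losses are small proportions of this, so [W] reaches [b e1], which
    exceeds the required terms. *)
Lemma long_intervals (kap Q R0 n0 N Y : nat) (a b kk : nat -> nat) (P : nat -> bool) :
  built kap Q R0 n0 a b -> floor_like Q kk -> dense_from N kk P ->
  16 * Q <= R0 -> 8 * Y <= R0 ->
  exists l0, forall l, l0 <= l -> exists F u W, within F P l /\ Y * cnt F l <= l /\
     covers F a u W /\ forall n, 1 <= n -> 32 * Q * (kap * kap) * n <= l -> a n <= W.
Proof.
  intros B FL HP HRQ HRY.
  pose proof (bl_reg _ _ _ _ _ _ B) as Hr. pose proof (reg_inc _ _ Hr) as I.
  pose proof (reg_kap _ _ Hr) as Hkap. pose proof (bl_Q _ _ _ _ _ _ B) as HQ.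
  pose proof (bl_R0 _ _ _ _ _ _ B) as HR0. pose proof (bl_n0 _ _ _ _ _ _ B) as Hn0.
  pose proof (E_of_pos Q) as HE. pose proof (G_of_pos Q) as HG.
  set (es := starts (len b Q R0) n0).
  set (A0 := 8 * Q * (kap * kap)).
  set (G3 := R0 * kap * (kap * (G_of Q * E_of Q))).
  destruct (base_interval _ _ _ _ _ _ _ _ _ B FL HP G3) as (F0 & T0 & u0 & HF0 & HC0).
  set (f0 := cnt F0 T0).
  set (cR := 2 * R0 * kap).
  set (CL := 16 * Q * (R0 * (384 * Q + 2))).
  set (C := 2 * G3 * (cR + 2) * CL).
  destruct (reg_log _ _ Hr (16 * (Q + Y) * C)) as (N1 & HN1).
  set (big := n0 + T0 + N1 + N + 1 + 16 * (Q + 1) + 4 * Y * f0 + 4).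
  assert (HA0 : 1 <= A0) by (unfold A0; nia).
  exists (2 * A0 * (2 * big)). intros l Hl.
  destruct (starts_bracket kap Q R0 n0 1 (l + 1) a b B ltac:(lia)) as (m & Hm1 & Hm2); [nia|].
  fold es in Hm1, Hm2. rewrite !Nat.mul_1_l in Hm1, Hm2. change (es (S m)) with (es m + len b Q R0 (es m)) in Hm2.
  pose proof (starts_ge (len b Q R0) n0 m : n0 <= es m) as Hem.
  pose proof (bl_len _ _ _ _ _ _ B (es m) Hem) as Hlen.
  set (e := es m) in *.
  assert (Hebig : A0 * (2 * big) <= e) by nia.
  destruct (starts_bracket kap Q R0 n0 A0 e a b B HA0) as (m1 & Hk1 & Hk2).
  { etransitivity; [|exact Hebig]. apply Nat.mul_le_mono_l. lia. }
  fold es in Hk1, Hk2. change (es (S m1)) with (es m1 + len b Q R0 (es m1)) in Hk2.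
  pose proof (starts_ge (len b Q R0) n0 m1 : n0 <= es m1) as He1n.
  pose proof (bl_len _ _ _ _ _ _ B (es m1) He1n) as Hlen1.
  set (e1 := es m1) in *.
  assert (He1big : big <= e1).
  { assert (2 * big < 2 * e1); [|lia]. apply Nat.mul_lt_mono_pos_l with (p := A0); [lia|].
    eapply Nat.le_lt_trans; [exact Hebig|]. eapply Nat.lt_le_trans; [exact Hk2|].
    apply Nat.mul_le_mono_l. lia. }
  assert (Hk3 : e < 2 * (A0 * e1)).
  { eapply Nat.lt_le_trans; [exact Hk2|].
    replace (2 * (A0 * e1)) with (A0 * (e1 + e1)) by ring. apply Nat.mul_le_mono_l. lia. }
  assert (He1e : e1 <= e).
  { transitivity (A0 * e1); [|exact Hk1]. rewrite <- (Nat.mul_1_l e1) at 1.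
    now apply Nat.mul_le_mono_r. }
  assert (Hm : exists i, m = m1 + i).
  { exists (m - m1). destruct (Nat.le_gt_cases m1 m) as [H|H]; [lia|exfalso].
    pose proof (starts_mono (len b Q R0) n0 (S m) (m1 - S m)) as M. fold es in M.
    replace (S m + (m1 - S m)) with m1 in M by lia. fold e1 in M.
    change (es (S m)) with (e + len b Q R0 e) in M. pose proof (len_pos b Q R0 e HQ HR0). lia. }
  destruct Hm as (i & Hi).
  set (D1 := Delta b e1). set (lo := D1 / kap).
  pose proof (bl_D _ _ _ _ _ _ B e1 He1n) as HD1. fold D1 in HD1.
  assert (HD1k : kap <= D1).
  { etransitivity; [|exact HD1]. rewrite <- (Nat.mul_1_r kap) at 1. apply Nat.mul_le_mono_l.
    apply (Nat.mul_le_mono 1 _ 1); easy. }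
  assert (Hlo : forall n, e1 <= n -> lo <= Delta b n).
  { intros n Hn. apply Nat.Div0.div_le_upper_bound. apply (reg_lo _ _ Hr). lia. }
  assert (Hlo2 : D1 <= 2 * kap * lo).
  { pose proof (Nat.div_mod D1 kap ltac:(lia)) as DM. fold lo in DM.
    pose proof (Nat.mod_upper_bound D1 kap ltac:(lia)).
    assert (1 <= lo) by (apply Nat.div_le_lower_bound; lia).
    assert (kap * 1 <= kap * lo) by now apply Nat.mul_le_mono_l. lia. }
  assert (Hbe1 : b e1 <= lo * (2 * (kap * kap) * e1)).
  { pose proof (term_le_gap kap e1 e1 b Hr (bl_b1 _ _ _ _ _ _ B e1 He1n) ltac:(lia)) as T.
    fold D1 in T. etransitivity; [exact T|].
    replace (lo * (2 * (kap * kap) * e1)) with (e1 * (kap * (2 * kap * lo))) by ring.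
    do 2 apply Nat.mul_le_mono_l. exact Hlo2. }
  destruct (blocks_pass kap Q R0 n0 lo m1 e f0 a b P F0 u0 B Hlo) with (i := i)
    as (F & u & W & r & ys & HC & HW & He & _ & Hr2 & Hc & Hg).
  { split; [|exact HC0]. apply (within_le _ _ T0); [fold es e1; lia|easy]. }
  { apply cnt_bounded. intros j Hj. now apply HF0. }
  { fold es. rewrite <- Hi. fold e. lia. }
  fold es in HC, He, Hc, Hg. fold e1 in He, Hg. fold G3 in Hr2.
  rewrite <- Hi in HC, He, Hc, Hg. fold e in HC, He, Hc, Hg.
  set (Lam := len b Q R0 e) in *.
  set (X := Nat.log2 (b e) + 1) in *.
  assert (HG3 : 1 <= G3).
  { unfold G3. rewrite <- !Nat.mul_assoc. repeat (apply (Nat.mul_le_mono 1 _ 1); [easy|]). easy. }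
  (* Both the number of switches and the length of a block are logarithmic, so the switched blocks
     are negligible by [reg_log]. *)
  assert (HrL : r * Lam <= C * X * X).
  { assert (Hrb : r < 2 * G3 * (X + cR + 1)).
    { apply pow_ratio; [lia|]. etransitivity; [exact Hr2|]. apply Nat.mul_le_mono_r.
      rewrite Nat.pow_add_r.
      assert (b e <= 2 ^ X).
      { unfold X. rewrite Nat.add_1_r. apply Nat.lt_le_incl, Nat.log2_spec.
        pose proof (increasing_ge b e I (reg_pos _ _ Hr) ltac:(lia)). lia. }
      assert (cR <= 2 ^ cR) by (apply Nat.lt_le_incl, Nat.pow_gt_lin_r; lia).
      transitivity (b e * cR); [unfold cR; apply Nat.eq_le_incl; ring|].
      now apply Nat.mul_le_mono. }
    assert (Hr3 : r <= 2 * G3 * (cR + 2) * X).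
    { etransitivity; [apply Nat.lt_le_incl, Hrb|]. rewrite <- (Nat.mul_assoc (2 * G3)).
      apply Nat.mul_le_mono_l. assert (HX : 1 <= X) by (unfold X; lia). clearbody X cR.
      clear - HX. nia. }
    assert (HL : Lam <= CL * X).
    { unfold Lam, len, wid, CL. replace (16 * Q * (R0 * (384 * Q + 2)) * X)
        with (16 * Q * (R0 * ((384 * Q + 2) * X))) by ring.
      do 2 apply Nat.mul_le_mono_l. unfold X. clear. nia. }
    etransitivity; [apply Nat.mul_le_mono; [exact Hr3|exact HL]|].
    apply Nat.eq_le_incl. unfold C. ring. }
  specialize (HN1 e ltac:(lia)). fold X in HN1.
  set (Z := r * Lam) in *.
  assert (HZ : 16 * (Q + Y) * Z <= e).
  { etransitivity; [|exact HN1]. rewrite <- !Nat.mul_assoc. do 2 apply Nat.mul_le_mono_l.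
    etransitivity; [exact HrL|]. apply Nat.eq_le_incl. ring. }
  clearbody Z X C Lam.
  assert (Hys : 16 * Q * R0 * ys <= e) by (rewrite He; apply Nat.le_add_l).
  (* Two indices per window are a small proportion, because the window length [R0] is at least
     [16 * Q] and [8 * Y]. *)
  assert (HysQ : 256 * (Q * (Q * ys)) <= e).
  { etransitivity; [|exact Hys]. replace (256 * (Q * (Q * ys))) with (16 * Q * ys * (16 * Q)) by ring.
    replace (16 * Q * R0 * ys) with (16 * Q * ys * R0) by ring. now apply Nat.mul_le_mono_l. }
  assert (HysY : 128 * (Y * (Q * ys)) <= e).
  { etransitivity; [|exact Hys]. replace (128 * (Y * (Q * ys))) with (16 * Q * ys * (8 * Y)) by ring.
    replace (16 * Q * R0 * ys) with (16 * Q * ys * R0) by ring. now apply Nat.mul_le_mono_l. }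
  exists F, u, W. split; [|split; [|split]].
  - apply (within_le _ _ (e - 1)); [clear - Hm1; lia|]. apply HC.
  - transitivity (Y * (f0 + Z + 32 * Q * ys)).
    + apply Nat.mul_le_mono_l. etransitivity; [|exact Hc].
      apply cnt_bounded. intros j Hj. now apply HC.
    + unfold big in He1big. clear - He1big He1e HZ HysY Hm1. lia.
  - apply HC.
  - intros n Hn HB.
    assert (Hne : n < e1).
    { apply Nat.mul_lt_mono_pos_l with (p := 4 * A0); [lia|].
      replace (32 * Q * (kap * kap) * n) with (4 * A0 * n) in HB by (unfold A0; ring).
      clear - HB Hm2 Hlen Hk3. lia. }
    transitivity (b e1).
    { pose proof (bl_ab _ _ _ _ _ _ B n Hn). pose proof (increasing_le b (S n) e1 I ltac:(lia)). lia. }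
    etransitivity; [exact Hbe1|].
    set (S1 := cnt P (e1 - 1) + Z + 4 * R0 * ys + 32 * Q * ys) in *.
    (* After all losses enough elements of [P] remain, each worth [lo], to reach the bound [Hbe1] on
       [b e1]. *)
    enough (Hfin : S1 + 2 * (kap * kap) * e1 <= cnt P (e - 1)).
    { apply (Nat.mul_le_mono_l _ _ lo) in Hfin. rewrite Nat.mul_add_distr_l in Hfin. lia. }
    pose proof (HP (e - 1) ltac:(lia)) as D. pose proof (fl_lower _ _ FL (e - 1)) as L1.
    assert (L2 : e - 1 <= Q * (cnt P (e - 1) + 1)).
    { etransitivity; [exact L1|]. apply Nat.mul_le_mono_l. lia. }
    apply Nat.mul_le_mono_pos_l with (p := Q); [lia|].
    pose proof (cnt_le P (e1 - 1)) as L3. apply (Nat.mul_le_mono_l _ _ Q) in L3.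
    assert (L4 : 8 * (Q * e1) <= e).
    { etransitivity; [|exact Hk1]. unfold A0.
      replace (8 * Q * (kap * kap) * e1) with (8 * (Q * e1) * (kap * kap)) by ring.
      rewrite <- (Nat.mul_1_r (8 * (Q * e1))) at 1. apply Nat.mul_le_mono_l.
      apply (Nat.mul_le_mono 1 kap 1 kap); easy. }
    assert (L5 : 8 * (Q * (kap * kap * e1)) <= e).
    { etransitivity; [|exact Hk1]. unfold A0. apply Nat.eq_le_incl. ring. }
    assert (L6 : 16 * (Q * (R0 * ys)) <= e) by (etransitivity; [|exact Hys]; apply Nat.eq_le_incl; ring).
    assert (L7 : 16 * (Q * Z) <= e).
    { etransitivity; [|exact HZ]. clear. lia. }
    assert (L8 : Q * (e1 - 1) <= Q * e1) by (apply Nat.mul_le_mono_l; lia).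
    unfold S1.
    replace (Q * (cnt P (e1 - 1) + Z + 4 * R0 * ys + 32 * Q * ys + 2 * (kap * kap) * e1))
      with (Q * cnt P (e1 - 1) + Q * Z + 4 * (Q * (R0 * ys)) + 32 * (Q * (Q * ys))
            + 2 * (Q * (kap * kap * e1))) by ring.
    rewrite Nat.mul_add_distr_l in L2.
    assert (L9 : 16 * (Q + 1) <= e) by (unfold big in He1big; clear - He1big He1e; lia).
    clear - L2 L3 L4 L5 L6 L7 L8 L9 HysQ. lia.
Qed.

(** * Consequences of friendliness *)

Lemma increasing_of_strictly (s : nat -> nat) : strictly_increasing s -> increasing s.
Proof.
  intros H i j [Hi Hj]. induction Hj as [|j Hj IH]; [now apply H|].
  specialize (H j ltac:(lia)). lia.
Qed.

Lemma length_filter_seq (f : nat -> bool) (x : nat) : length (filter f (seq 1 x)) = cnt f x.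
Proof.
  induction x as [|x IH]; [easy|]. rewrite seq_S, filter_app, length_app, IH, cnt_S.
  unfold ind. cbn [filter Nat.add]. destruct (f (S x)); easy.
Qed.

Lemma cntle_eq (P : nat -> bool) (s : nat -> nat) (x n : nat) :
  n <= x -> (forall k, 1 <= k -> (s k <= x <-> k <= n)) -> cntle P s x = cnt P n.
Proof.
  intros Hn H. unfold cntle. rewrite length_filter_seq.
  set (f := fun k => andb (P k) (s k <=? x)).
  replace (cnt f x) with (cnt f (n + (x - n))) by (f_equal; lia). rewrite cnt_add.
  assert (E1 : cnt f n = cnt P n).
  { apply psum_ext. intros j Hj. unfold ind, f.
    destruct (Nat.leb_spec (s j) x) as [L|L]; [now rewrite Bool.andb_true_r|].
    assert (s j <= x) by (apply H; lia). lia. }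
  assert (E2 : cnt (shift n f) (x - n) = 0).
  { unfold cnt. rewrite (psum_ext _ (fun _ => 0)), psum_const; [lia|].
    intros j Hj. unfold ind, shift, f. destruct (Nat.leb_spec (s (n + j)) x) as [L|L].
    - apply H in L; lia.
    - now rewrite Bool.andb_false_r. }
  lia.
Qed.

(** At a term of the sequence, counting by values is counting by indices. *)
Lemma cntle_term (P : nat -> bool) (s : nat -> nat) (n : nat) :
  increasing s -> 1 <= s 1 -> 1 <= n -> cntle P s (s n) = cnt P n.
Proof.
  intros I H1 Hn. apply cntle_eq; [now apply increasing_ge|].
  intros k Hk. split; intros H.
  - apply Nat.nlt_ge. intros C. specialize (I n k ltac:(lia)). lia.
  - apply increasing_le; [easy|lia].
Qed.

Lemma cnt_true (n : nat) : cnt (fun _ => true) n = n.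
Proof. unfold cnt. rewrite (psum_ext _ (fun _ => 1)) by easy. rewrite psum_const. lia. Qed.

Lemma Bcount_spec (s : nat -> nat) (x : nat) :
  increasing s -> 1 <= s 1 -> forall k, 1 <= k -> (s k <= x <-> k <= Bcount s x).
Proof.
  intros I H1.
  destruct (least_from (fun n => x <? s (S n)) 0) as (n & _ & L1 & L2).
  { exists x. split; [lia|]. apply Nat.ltb_lt. pose proof (increasing_ge s (S x) I H1). lia. }
  apply Nat.ltb_lt in L1.
  assert (A : forall k, 1 <= k -> (s k <= x <-> k <= n)).
  { intros k Hk. split; intros H.
    - apply Nat.nlt_ge. intros C. pose proof (increasing_le s (S n) k I ltac:(lia)). lia.
    - specialize (L2 (k - 1) ltac:(lia)). apply Nat.ltb_ge in L2.
      now replace (S (k - 1)) with k in L2 by lia. }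
  assert (Hnx : n <= x).
  { destruct (Nat.eq_dec n 0) as [->|E]; [lia|].
    pose proof (proj2 (A n ltac:(lia)) ltac:(lia)). pose proof (increasing_ge s n I H1). lia. }
  unfold Bcount. rewrite (cntle_eq _ _ _ n Hnx A), cnt_true. exact A.
Qed.

Lemma nat_above (x : R) : exists n : nat, (x <= INR n)%R.
Proof.
  destruct (INR_unbounded x) as (n & Hn). exists n. lra.
Qed.

Lemma dyadic_counts (b : nat -> nat) :
  (forall M : R, exists I : nat, forall i, (1 <= i)%nat -> (I <= i)%nat ->
      (M <= INR (Bcount b (2 ^ (S i)) - Bcount b (2 ^ i)) / INR i)%R) ->
  forall C, exists I, 1 <= I /\ forall i, I <= i ->
    Bcount b (2 ^ i) + C * i <= Bcount b (2 ^ (S i)).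
Proof.
  intros H C. destruct (H (INR C + 1)%R) as (I & HI). exists (S I). split; [lia|].
  intros i Hi. specialize (HI i ltac:(lia) ltac:(lia)).
  assert (Hpos : (0 < INR i)%R) by (apply lt_0_INR; lia).
  apply Rmult_le_compat_r with (r := INR i) in HI; [|lra].
  unfold Rdiv in HI. rewrite Rmult_assoc, Rinv_l, Rmult_1_r in HI by lra.
  assert (HC : (INR (C * i) < INR (Bcount b (2 ^ S i) - Bcount b (2 ^ i)))%R).
  { rewrite mult_INR. lra. }
  apply INR_lt in HC. lia.
Qed.

(** With [x] the logarithm of [b n], condition (iii) puts a large multiple of [x + 1] terms between
    [2 ^ (x + 1)] and [2 ^ (x + 2)]. They come after [n], so their gaps are at least
    [Delta b n / kap], while the range has length at most [2 * b n]. *)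
Lemma gaps_small (kap : nat) (b : nat -> nat) :
  increasing b -> 1 <= b 1 ->
  (forall i j, 1 <= i <= j -> Delta b i <= kap * Delta b j) ->
  (forall C, exists I, 1 <= I /\ forall i, I <= i ->
    Bcount b (2 ^ i) + C * i <= Bcount b (2 ^ (S i))) ->
  forall C, exists N, forall n, N <= n -> C * (Nat.log2 (b n) + 1) * Delta b n <= b n.
Proof.
  intros I H1 Hlo HB C.
  destruct (HB (2 * kap * C + 1)) as (J & HJ1 & HJ).
  exists (2 ^ J). intros n Hn.
  assert (Hn1 : 1 <= n) by (pose proof (Nat.pow_nonzero 2 J ltac:(lia)); lia).
  pose proof (increasing_ge b n I H1 Hn1) as Hbn.
  set (x := Nat.log2 (b n)).
  destruct (Nat.log2_spec (b n) ltac:(lia)) as [X1 X2]. fold x in X1, X2.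
  assert (HxJ : J <= S x).
  { apply Nat.nlt_ge. intros Cc. assert (2 ^ S x <= 2 ^ J) by (apply Nat.pow_le_mono_r; lia). lia. }
  specialize (HJ (S x) HxJ).
  set (p := Bcount b (2 ^ S x)) in *. set (q := Bcount b (2 ^ S (S x))) in *.
  pose proof (Bcount_spec b (2 ^ S x) I H1) as Sp. fold p in Sp.
  pose proof (Bcount_spec b (2 ^ S (S x)) I H1) as Sq. fold q in Sq.
  assert (Hnp : n <= p) by (apply Sp; [easy|lia]).
  assert (Hq : b q <= 2 ^ S (S x)) by (apply Sq; lia).
  assert (Hp : 2 ^ S x < b (S p)).
  { apply Nat.nle_gt. intros Cc. apply Sp in Cc; lia. }
  assert (A : forall i, kap * b (S p) + i * Delta b n <= kap * b (S p + i)).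
  { induction i as [|i IH]; [rewrite (Nat.add_0_r (S p)); lia|].
    rewrite Nat.add_succ_r, (Delta_spec b (S p + i) I ltac:(lia)).
    pose proof (Hlo n (S p + i) ltac:(lia)). lia. }
  specialize (A (q - S p)). replace (S p + (q - S p)) with q in A by nia.
  rewrite (Nat.pow_succ_r' 2 (S x)) in Hq. rewrite (Nat.pow_succ_r' 2 x) in *.
  set (t := 2 ^ x) in *.
  assert (Hk : kap * b q <= kap * (2 * (2 * t))) by now apply Nat.mul_le_mono_l.
  assert (Hk' : kap * (2 * t) <= kap * b (S p)) by (apply Nat.mul_le_mono_l; lia).
  assert (Hk'' : kap * t <= kap * b n) by now apply Nat.mul_le_mono_l.
  assert (B : (q - S p) * Delta b n <= 2 * kap * b n) by lia.
  assert (D : 2 * kap * (C * (x + 1)) <= q - S p) by lia.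
  assert (D' : 2 * kap * (C * (x + 1) * Delta b n) <= 2 * kap * b n).
  { etransitivity; [|exact B]. rewrite Nat.mul_assoc. now apply Nat.mul_le_mono_r. }
  destruct (Nat.eq_dec kap 0) as [K0|K0].
  - pose proof (Hlo n n ltac:(lia)). rewrite K0 in *. replace (Delta b n) with 0 by lia. lia.
  - apply Nat.mul_le_mono_pos_l with (p := 2 * kap); [lia|easy].
Qed.

(** Summing condition (iii) over the dyadic ranges up to [2 ^ x] shows that [n] is at least about
    [8 * C * x * x]. *)
Lemma log_small (b : nat -> nat) :
  increasing b -> 1 <= b 1 ->
  (forall C, exists I, 1 <= I /\ forall i, I <= i ->
    Bcount b (2 ^ i) + C * i <= Bcount b (2 ^ (S i))) ->
  forall C, exists N, forall n, N <= n ->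
    C * (Nat.log2 (b n) + 1) * (Nat.log2 (b n) + 1) <= n.
Proof.
  intros I H1 HB C. destruct (HB (16 * C)) as (J & HJ1 & HJ).
  exists (2 ^ (2 * J + 8)). intros n Hn.
  assert (Hn1 : 1 <= n) by (pose proof (Nat.pow_nonzero 2 (2 * J + 8) ltac:(lia)); lia).
  pose proof (increasing_ge b n I H1 Hn1) as Hbn.
  set (x := Nat.log2 (b n)).
  destruct (Nat.log2_spec (b n) ltac:(lia)) as [X1 X2]. fold x in X1, X2.
  assert (Hx : 2 * J + 8 <= x).
  { apply Nat.nlt_ge. intros Cc.
    assert (2 ^ S x <= 2 ^ (2 * J + 8)) by (apply Nat.pow_le_mono_r; lia). lia. }
  assert (Hc : Bcount b (2 ^ x) <= n).
  { destruct (Nat.eq_dec (Bcount b (2 ^ x)) 0) as [E|E]; [lia|].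
    apply Nat.nlt_ge. intros Cc. pose proof (I n (Bcount b (2 ^ x)) ltac:(lia)).
    pose proof (proj2 (Bcount_spec b (2 ^ x) I H1 (Bcount b (2 ^ x)) ltac:(lia)) ltac:(lia)). lia. }
  assert (A : forall i, 16 * C * ((J + i) * (J + i)) <=
             2 * Bcount b (2 ^ (J + i)) + 16 * C * (J + i) + 16 * C * (J * J)).
  { induction i as [|i IH]; [rewrite Nat.add_0_r; lia|].
    rewrite Nat.add_succ_r. specialize (HJ (J + i) ltac:(lia)).
    set (y := J + i) in *. set (d := 16 * C) in *.
    replace (d * (S y * S y)) with (d * (y * y) + 2 * (d * y) + d) by ring. lia. }
  specialize (A (x - J)). replace (J + (x - J)) with x in A by lia.
  assert (B : 4 * (J * J) <= x * x) by (clear - Hx; nia).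
  assert (B' : 8 * x <= x * x) by (clear - Hx; nia).
  apply (Nat.mul_le_mono_l _ _ C) in B, B'.
  assert (B'' : C * ((x + 1) * (x + 1)) <= C * (4 * (x * x))) by (apply Nat.mul_le_mono_l; nia).
  rewrite <- Nat.mul_assoc. lia.
Qed.

Lemma regular_of_friendly (eps : R) (b : nat -> nat) :
  eps_friendly eps b -> exists kap, regular kap b.
Proof.
  intros (Hpos & _ & Hinf & Hdy & (c & Hc & Hgap) & Hinc).
  pose proof (increasing_of_strictly b Hinc) as I.
  assert (H1 : 1 <= b 1) by (apply Hpos; lia).
  destruct (nat_above (/ c)) as (k & Hk). set (kap := S k).
  assert (Hc' : (/ c <= INR kap)%R) by (unfold kap; rewrite S_INR; lra).
  assert (Hscale : forall u v : nat, (INR u <= / c * INR v)%R -> u <= kap * v).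
  { intros u v H. apply INR_le. rewrite mult_INR. etransitivity; [exact H|].
    apply Rmult_le_compat_r; [apply pos_INR|easy]. }
  assert (Hlo : forall i j, 1 <= i <= j -> Delta b i <= kap * Delta b j).
  { intros i j Hij. destruct (Nat.eq_dec i j) as [->|E]; [nia|].
    apply Hscale. destruct (Hgap i j ltac:(lia) ltac:(lia)) as [H _].
    apply Rmult_le_compat_l with (r := (/ c)%R) in H.
    - rewrite <- Rmult_assoc, Rinv_l, Rmult_1_l in H by lra. exact H.
    - left. apply Rinv_0_lt_compat. lra. }
  pose proof (dyadic_counts b Hdy) as HB.
  exists kap. constructor; try easy.
  - unfold kap. lia.
  - intros i j Hij Hb. destruct (Nat.eq_dec i j) as [->|E]; [nia|].
    apply Hscale. now apply Hgap; try lia.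
  - now apply (gaps_small kap).
  - now apply log_small.
Qed.

(** * The integer part of [eps * n] and the final assembly *)

Definition floor_mul (eps : R) (n : nat) : nat := Z.to_nat (Int_part (eps * INR n)).

Lemma Int_part_le (r : R) (k : nat) : (r <= INR k)%R -> Z.to_nat (Int_part r) <= k.
Proof.
  intros H. destruct (base_Int_part r) as [H1 _].
  enough (Int_part r <= Z.of_nat k)%Z by lia.
  apply le_IZR. rewrite <- INR_IZR_INZ. lra.
Qed.

Lemma floor_mul_spec (eps : R) (n : nat) :
  (0 < eps)%R -> (INR (floor_mul eps n) <= eps * INR n < INR (floor_mul eps n) + 1)%R.
Proof.
  intros He. unfold floor_mul. destruct (base_Int_part (eps * INR n)) as [H1 H2].
  assert (Hn : (0 <= eps * INR n)%R) by (apply Rmult_le_pos; [lra|apply pos_INR]).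
  assert (Hz : (0 <= Int_part (eps * INR n))%Z).
  { enough (-1 < Int_part (eps * INR n))%Z by lia. apply lt_IZR. lra. }
  rewrite INR_IZR_INZ, Z2Nat.id by easy. lra.
Qed.

Lemma floor_mul_floor_like (eps : R) :
  (0 < eps < 1)%R -> exists Q, 1 <= Q /\ floor_like Q (floor_mul eps).
Proof.
  intros He. destruct (nat_above (/ eps)) as (q1 & Hq1). destruct (nat_above (/ (1 - eps))) as (q2 & Hq2).
  set (Q := S (q1 + q2)).
  assert (HQ : (INR Q = INR q1 + INR q2 + 1)%R) by (unfold Q; rewrite S_INR, plus_INR; lra).
  pose proof (pos_INR q1). pose proof (pos_INR q2).
  assert (Q1 : (1 <= INR Q * eps)%R).
  { apply Rmult_le_reg_r with (/ eps)%R; [apply Rinv_0_lt_compat; lra|].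
    rewrite Rmult_assoc, Rinv_r by lra. lra. }
  assert (Q2 : (1 <= INR Q * (1 - eps))%R).
  { apply Rmult_le_reg_r with (/ (1 - eps))%R; [apply Rinv_0_lt_compat; lra|].
    rewrite Rmult_assoc, Rinv_r by lra. lra. }
  exists Q. split; [unfold Q; lia|]. constructor.
  - intros m n Hmn. apply le_INR in Hmn.
    pose proof (floor_mul_spec eps m (proj1 He)). pose proof (floor_mul_spec eps n (proj1 He)).
    apply Nat.lt_succ_r, INR_lt. rewrite S_INR.
    assert (eps * INR m <= eps * INR n)%R by (apply Rmult_le_compat_l; lra). lra.
  - intros n. pose proof (floor_mul_spec eps n (proj1 He)). apply INR_le.
    rewrite mult_INR, plus_INR. change (INR 1) with 1%R. pose proof (pos_INR n).
    transitivity (INR Q * (eps * INR n))%R; [nra|]. apply Rmult_le_compat_l; lra.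
  - intros n. pose proof (floor_mul_spec eps n (proj1 He)). apply INR_le.
    rewrite plus_INR, !mult_INR. pose proof (pos_INR n).
    assert (INR Q * INR (floor_mul eps n) <= INR Q * (eps * INR n))%R
      by (apply Rmult_le_compat_l; lra). nra.
Qed.

Lemma steep_of_regular (kap n0 : nat) (a b : nat -> nat) :
  regular kap b -> (forall n, 1 <= n -> b n <= a n < b (S n)) ->
  (forall n, n0 <= n -> b 1 <= Delta b n) -> steep kap n0 a.
Proof.
  intros Hr Hab Hb1 r x y Hx Hrx Hxy.
  assert (A : forall i, i * a r + kap * (r + 1) * b (x + 1) <= kap * (r + 1) * b (x + 1 + i)).
  { induction i as [|i IH]; [rewrite (Nat.add_0_r (x + 1)); lia|].
    rewrite (Nat.add_succ_r (x + 1)), (Delta_spec b (x + 1 + i) (reg_inc _ _ Hr)) by lia.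
    pose proof (term_le_gap kap (r + 1) (x + 1 + i) b Hr (Hb1 (x + 1 + i) ltac:(lia)) ltac:(lia)) as T.
    pose proof (Hab r ltac:(lia)) as R. rewrite <- Nat.add_1_r in R.
    replace (kap * (r + 1) * (b (x + 1 + i) + Delta b (x + 1 + i))) with
      (kap * (r + 1) * b (x + 1 + i) + (r + 1) * (kap * Delta b (x + 1 + i))) by ring. lia. }
  specialize (A (y - x - 1)). replace (x + 1 + (y - x - 1)) with y in A by lia.
  pose proof (Hab x ltac:(lia)) as Ax. pose proof (Hab y ltac:(lia)) as Ay.
  rewrite <- Nat.add_1_r in Ax.
  transitivity (kap * (r + 1) * (b y - b (x + 1))).
  - rewrite Nat.mul_sub_distr_l. lia.
  - apply Nat.mul_le_mono_l. lia.
Qed.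

Open Scope R_scope.

Theorem theorem4p3 (eps : R) (b : nat -> nat) :
  0 < eps < 1 -> eps_friendly eps b ->
  exists a : nat -> nat,
    positive_seq a /\
    (forall n, (1 <= n)%nat -> (b n <= a n)%nat /\ (a n < b (S n))%nat) /\
    eps_complete eps a.
Proof.
  intros He Hfr.
  destruct (regular_of_friendly eps b Hfr) as (kap & Hr).
  destruct (floor_mul_floor_like eps He) as (Q & HQ & FL).
  destruct Hfr as (_ & (C & HC) & _).
  pose proof (reg_kap _ _ Hr) as Hkap. pose proof (reg_inc _ _ Hr) as Ib.
  (* [B0], [K] and [Y] depend only on [Q] and [kap], so [R0], and with it the block length, can be
     taken large in terms of them before [a] is constructed. *)
  set (B0 := (32 * Q * (kap * kap))%nat).
  set (K := (16 * Q * Q * B0)%nat).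
  set (Y := (4 * B0 * Q * K * (4 * K * kap + 2))%nat).
  set (R0 := (16 * Q + 8 * Y)%nat).
  destruct (reg_inf _ _ Hr (kap * (G_of Q * E_of Q) + b 1%nat)%nat) as (N1 & HN1).
  destruct (reg_log _ _ Hr (16 * Q * (R0 * (384 * Q + 2)))%nat) as (N2 & HN2).
  destruct (block_sequence kap Q R0 (N1 + N2) b Hr HQ ltac:(unfold R0; lia))
    as (n0 & a & Hnx & Hn0 & Hab & Hmod & Hsm & Hsw).
  assert (B : built kap Q R0 n0 a b).
  { constructor; try easy.
    - unfold R0. lia.
    - intros n Hn. specialize (HN1 n ltac:(lia)). lia.
    - intros n Hn. specialize (HN1 n ltac:(lia)). lia.
    - intros n Hn. specialize (HN2 n ltac:(lia)). etransitivity; [|exact HN2].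
      unfold len, wid. set (x := Nat.log2 (b n)). clearbody R0.
      replace (16 * Q * (R0 * (384 * Q + 2)) * (x + 1) * (x + 1))%nat
        with (16 * Q * (R0 * ((384 * Q + 2) * ((x + 1) * (x + 1)))))%nat by ring.
      do 2 apply Nat.mul_le_mono_l. clear. nia. }
  assert (Ia : increasing a).
  { intros i j Hij. pose proof (Hab i ltac:(lia)). pose proof (Hab j ltac:(lia)).
    pose proof (increasing_le b (S i) j Ib ltac:(lia)). lia. }
  assert (Ha1 : (1 <= a 1)%nat) by (pose proof (Hab 1%nat ltac:(lia)); pose proof (reg_pos _ _ Hr); lia).
  exists a. split; [|split].
  - intros n Hn. pose proof (increasing_ge a n Ia Ha1 Hn). lia.
  - intros n Hn. apply Hab in Hn. lia.
  - intros P (N & HN).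
    assert (HP : dense_from (N + 1) (floor_mul eps) P).
    { intros n Hn. pose proof (increasing_ge a n Ia Ha1 ltac:(lia)) as Hge.
      (* Taken at the value [a n], the density hypothesis reads [eps * n <= cnt P n]. *)
      specialize (HN (a n) ltac:(lia)).
      unfold Bcount in HN. rewrite !cntle_term, cnt_true in HN by (easy || lia).
      apply Int_part_le. exact HN. }
    destruct (nat_above C) as (c0 & Hc0).
    assert (HB0 : (1 <= B0)%nat).
    { unfold B0. apply (Nat.mul_le_mono 1 (32 * Q) 1 (kap * kap)); [lia|].
      apply (Nat.mul_le_mono 1 kap 1 kap); easy. }
    (* Condition (i) is applied to [b (S i)], which exceeds [a i]: passing to [S i] costs [eps < 1]
       and rounding less than 1, hence [c0 + 2]. *)
    apply (complete_of_intervals P a (floor_mul eps) Q kap (c0 + 2) n0 B0 (N + 1)); try easy.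
    + apply (steep_of_regular kap n0 a b Hr Hab). apply (bl_b1 _ _ _ _ _ _ B).
    + intros i Hi. pose proof (Hab i Hi) as H. specialize (HC (S i) ltac:(lia)).
      transitivity (psum b (Z.to_nat (Int_part (eps * INR (S i) + C)))); [lia|].
      transitivity (psum b (floor_mul eps i + (c0 + 2))).
      * apply psum_mono, Int_part_le. rewrite S_INR, !plus_INR.
        pose proof (floor_mul_spec eps i (proj1 He)). change (INR 2) with 2. lra.
      * apply psum_le. intros j Hj. apply Hab. lia.
    + apply (long_intervals kap Q R0 n0 (N + 1) Y a b (floor_mul eps) P); try easy; unfold R0; lia.
Qed.
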